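(* Let $\Delta$ be a simplicial complex on $[n]$ and $i\in[n]$. For every $q\ge 0$ there is an isomorphism of $\mathbb{Z}^n$-graded $S'$-modules $$H^q_{\mathfrak p_i}(k[\Delta])\;\cong\;H^q_{\mathfrak m'}\big(k[\operatorname{del}_\Delta(i)]\big)\ \oplus\ \Big(H^q_{\mathfrak m'}\big(k[\operatorname{lk}_\Delta(i)]\big)\otimes_k x_i\,k[x_i]\Big),$$ where the first summand sits in $x_i$-degree $0$ and the factor $x_i k[x_i]=\bigoplus_{c\ge1}k\,x_i^c$ records the $x_i$-grading of the second summand (so the link term is repeated in each $x_i$-degree $\ge 1$). Equivalently, in a fixed multidegree $a=(c;b)$ with $c=a_i\in\mathbb{Z}$ and $b\in\mathbb{Z}^{[n]\setminus\{i\}}$, $$H^q_{\mathfrak p_i}(k[\Delta])_a\;\cong\;\begin{cases}H^q_{\mathfrak m'}\big(k[\operatorname{del}_\Delta(i)]\big)_b,& c=0,\\ H^q_{\mathfrak m'}\big(k[\operatorname{lk}_\Delta(i)]\big)_b,& c\ge 1,\\ 0,& c\le -1.\end{cases}$$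
   Context: $k$ is a field, $[n]=\{1,\dots,n\}$, $S=k[x_1,\dots,x_n]$ with the $\mathbb{Z}^n$-grading $\deg x_j=\mathbf e_j$. A simplicial complex on $[n]$ is a family of subsets (faces) of $[n]$ closed under passing to subsets; by convention every singleton $\{j\}$, $j\in[n]$, is a face of $\Delta$. The Stanley--Reisner ideal $I_\Delta\subseteq S$ is generated by the monomials $\prod_{j\in\tau}x_j$ with $\tau\subseteq[n]$, $\tau\notin\Delta$, and $k[\Delta]=S/I_\Delta$. For a vertex $i$: $\operatorname{del}_\Delta(i)=\{\tau\in\Delta: i\notin\tau\}$ (deletion) and $\operatorname{lk}_\Delta(i)=\{\tau\subseteq[n]\setminus\{i\}:\tau\cup\{i\}\in\Delta\}$ (link). Both are regarded as complexes on the ambient set $[n]\setminus\{i\}$ (not every element of which need be a vertex), so their Stanley--Reisner rings are quotients of $S'=k[x_j:j\ne i]$, whose maximal graded ideal is $\mathfrak m'=(x_j:j\ne i)\subseteq S'$. The vertex prime is $\mathfrak p_i=(x_j:j\ne i)\subseteq S$. $H^q_{\mathfrak a}(M)$ denotes the $q$-th local cohomology module of $M$ with support in $\mathfrak a$, with its natural multigrading when $\mathfrak a$ is monomial and $M$ is multigraded. A multidegree $a\in\mathbb{Z}^n$ is written $a=(c;b)$ with $c=a_i$ and $b=(a_j)_{j\ne i}$. *)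

(* Defs.v *)
From HB Require Import structures.
From mathcomp Require Import all_boot all_order all_algebra.
From mathcomp Require Import boolp classical_sets functions.
From mathcomp Require Import mpoly.

Set Implicit Arguments.
Unset Strict Implicit.
Unset Printing Implicit Defensive.
Import Order.TTheory GRing.Theory Num.Theory.
Local Open Scope ring_scope.
Local Open Scope quotient_scope.

(* Graded modules over k[x_1, ..., x_n], where x_j has degree w j in an        *)
(* abelian group A. The decomposition M = \bigoplus_a M_a is given by its      *)
(* projections hcomp a, so that M_a = {m | hcomp a m = m}.                     *)
Record gmod (k : fieldType) (n : nat) (A : zmodType) (w : 'I_n -> A) := GMod {
  gsort :> lmodType {mpoly k[n]};
  hcomp : A -> gsort -> gsort;
  hcompD : forall a x y, hcomp a (x + y) = hcomp a x + hcomp a y;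
  hcomp_id : forall a b x, hcomp a (hcomp b x) = if a == b then hcomp b x else 0;
  hcomp_sum : forall x, exists2 s : seq A, uniq s & x = \sum_(a <- s) hcomp a x;
  hcompC : forall (c : k) a x, hcomp a (c%:MP *: x) = c%:MP *: hcomp a x;
  hcompX : forall j a x, hcomp (w j + a) ('X_j *: x) = 'X_j *: hcomp a x
}.

Section GradedTheory.
Variables (k : fieldType) (n : nat) (A : zmodType) (w : 'I_n -> A).
Implicit Types M N : gmod k w.

Lemma hcomp_zmod M a : zmod_morphism (@hcomp _ _ _ _ M a).
Proof.
move=> x y; have h0 : hcomp a 0 = 0 :> M.
  by apply: (addrI (hcomp a 0)); rewrite -hcompD !addr0.
have hN z : hcomp a (- z) = - hcomp a z :> M.
  by apply/eqP; rewrite -addr_eq0 -hcompD addNr h0.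
by rewrite hcompD hN.
Qed.

HB.instance Definition _ M a :=
  GRing.isZmodMorphism.Build M M (@hcomp _ _ _ _ M a) (hcomp_zmod a).

Record ghom M N := GHom {
  ghom_fun :> {linear M -> N};
  ghom_hcomp : forall a x, ghom_fun (hcomp a x) = hcomp a (ghom_fun x)
}.

Definition giso M N : Prop := exists f : ghom M N, bijective f.

(* Injective objects of the category of A-graded modules and degree-preserving *)
(* homomorphisms.                                                              *)
Definition ginjective (I : gmod k w) : Prop :=
  forall (M N : gmod k w) (j : ghom M N) (f : ghom M I), injective j ->
    exists g : ghom N I, forall x, g (j x) = f x.

Record ginjective_resolution M := GInjRes {
  res_mod : nat -> gmod k w;
  res_aug : ghom M (res_mod 0);
  res_diff : forall q, ghom (res_mod q) (res_mod q.+1);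
  res_inj : forall q, ginjective (res_mod q);
  res_aug_inj : injective res_aug;
  res_exact0 : forall x, res_diff 0 x = 0 <-> exists y, res_aug y = x;
  res_exactS : forall q x, res_diff q.+1 x = 0 <-> exists y, res_diff q y = x
}.

Record hsubmod M := HSubmod {
  hsub_pred : {pred M};
  hsub_closed : submod_closed hsub_pred;
  hsub_hcomp : forall a x, x \in hsub_pred -> hcomp a x \in hsub_pred
}.

HB.instance Definition _ M (P : hsubmod M) :=
  GRing.isSubmodClosed.Build _ M (hsub_pred P) (GRing.submod_closed_semi (hsub_closed P)).

Definition wdeg (e : 'X_{1..n}) : A := \sum_(j < n) w j *+ e j.

Lemma wdeg0 : wdeg 0%MM = 0.
Proof. by rewrite /wdeg big1 // => j _; rewrite mnm0E. Qed.

Lemma wdegD e f : wdeg (e + f)%MM = wdeg e + wdeg f.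
Proof. by rewrite /wdeg -big_split; apply: eq_bigr => j _; rewrite mnmDE mulrnDr. Qed.

Lemma wdegU j : wdeg U_(j)%MM = w j.
Proof.
rewrite /wdeg (bigD1 j) //= mnm1E eqxx mulr1n big1 ?addr0 // => l nlj.
by rewrite mnm1E eq_sym (negbTE nlj).
Qed.

Lemma hcomp_monom M e a (x : M) :
  hcomp (wdeg e + a) ('X_[e] *: x) = 'X_[e] *: hcomp a x.
Proof.
rewrite mpolyXE_id /wdeg; elim: (index_enum _) x => [|j s IHs] x.
  by rewrite !big_nil add0r !scale1r.
rewrite !big_cons -!scalerA -addrA; move: (e j) => c.
elim: c => [|c IHc]; first by rewrite mulr0n add0r expr0 !scale1r IHs.
by rewrite mulrS exprS -!scalerA -addrA hcompX IHc.
Qed.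

End GradedTheory.

Arguments ginjective_resolution {k n A w} M.
Arguments res_mod {k n A w M} _ _.

Section SubmoduleAndQuotient.
Variables (k : fieldType) (n : nat) (A : zmodType) (w : 'I_n -> A).
Variables (M : gmod k w) (P : hsubmod M).

Definition sub_sort := {x : M | x \in hsub_pred P}.
HB.instance Definition _ := SubChoice.on sub_sort.
HB.instance Definition _ := [SubChoice_isSubLmodule of sub_sort by <:].

Definition sub_hcomp (a : A) (x : sub_sort) : sub_sort :=
  Sub (hcomp a (val x)) (hsub_hcomp a (valP x)).

Lemma sub_hcompD a x y : sub_hcomp a (x + y) = sub_hcomp a x + sub_hcomp a y.
Proof. by apply: val_inj; rewrite /= hcompD. Qed.

Lemma sub_hcomp_id a b x :
  sub_hcomp a (sub_hcomp b x) = if a == b then sub_hcomp b x else 0.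
Proof. by apply: val_inj; rewrite /= hcomp_id; case: ifP. Qed.

Lemma sub_hcomp_sum x :
  exists2 s : seq A, uniq s & x = \sum_(a <- s) sub_hcomp a x.
Proof.
have [s us xE] := hcomp_sum (val x); exists s => //.
by apply: val_inj; rewrite [LHS]xE raddf_sum.
Qed.

Lemma sub_hcompC (c : k) a x : sub_hcomp a (c%:MP *: x) = c%:MP *: sub_hcomp a x.
Proof. by apply: val_inj; rewrite /= hcompC. Qed.

Lemma sub_hcompX j a x : sub_hcomp (w j + a) ('X_j *: x) = 'X_j *: sub_hcomp a x.
Proof. by apply: val_inj; rewrite /= hcompX. Qed.

Definition gsub : gmod k w :=
  GMod sub_hcompD sub_hcomp_id sub_hcomp_sum sub_hcompC sub_hcompX.

Definition quo_sort := {ideal_quot (hsub_pred P)}.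
HB.instance Definition _ := GRing.Zmodule.on quo_sort.

Definition quo_pi : M -> quo_sort := \pi_quo_sort.

Lemma quo_piD x y : quo_pi (x + y) = quo_pi x + quo_pi y.
Proof. exact: (raddfD (\pi_quo_sort : {additive M -> quo_sort})). Qed.

Lemma quo_eqP x y : quo_pi x = quo_pi y <-> x - y \in hsub_pred P.
Proof.
have := Quotient.idealrBE (hsub_pred P) x y.
by rewrite -/quo_sort => ->; split=> /eqP.
Qed.

Lemma quo_repr x : repr (quo_pi x) - x \in hsub_pred P.
Proof. by apply/quo_eqP; rewrite /quo_pi reprK. Qed.

Lemma quo_piK (u : quo_sort) : exists x, u = quo_pi x.
Proof. by exists (repr u); rewrite /quo_pi reprK. Qed.

Definition quo_scale (s : {mpoly k[n]}) (u : quo_sort) := quo_pi (s *: repr u).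

Lemma quo_scaleE s x : quo_scale s (quo_pi x) = quo_pi (s *: x).
Proof. by apply/quo_eqP; rewrite -scalerBr rpredZ ?quo_repr. Qed.

Lemma quo_scaleA s t u : quo_scale s (quo_scale t u) = quo_scale (s * t) u.
Proof. by have [x ->] := quo_piK u; rewrite !quo_scaleE scalerA. Qed.

Lemma quo_scale1 : left_id 1 quo_scale.
Proof. by move=> u; have [x ->] := quo_piK u; rewrite !quo_scaleE scale1r. Qed.

Lemma quo_scaleDr : right_distributive quo_scale +%R.
Proof.
move=> s u v; have [x ->] := quo_piK u; have [y ->] := quo_piK v.
by rewrite -quo_piD !quo_scaleE scalerDr quo_piD.
Qed.

Lemma quo_scaleDl u : {morph quo_scale^~ u : s t / s + t}.
Proof. by move=> s t; have [x ->] := quo_piK u; rewrite !quo_scaleE scalerDl quo_piD. Qed.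

HB.instance Definition _ := GRing.Zmodule_isLmodule.Build {mpoly k[n]} quo_sort
  quo_scaleA quo_scale1 quo_scaleDr quo_scaleDl.

Lemma quo_piZ s x : quo_pi (s *: x) = s *: quo_pi x.
Proof. by rewrite -quo_scaleE. Qed.

Definition quo_hcomp (a : A) (u : quo_sort) : quo_sort := quo_pi (hcomp a (repr u)).

Lemma quo_hcompE a x : quo_hcomp a (quo_pi x) = quo_pi (hcomp a x).
Proof. by apply/quo_eqP; rewrite -raddfB hsub_hcomp ?quo_repr. Qed.

Lemma quo_hcompD a u v : quo_hcomp a (u + v) = quo_hcomp a u + quo_hcomp a v.
Proof.
have [x ->] := quo_piK u; have [y ->] := quo_piK v.
by rewrite -quo_piD !quo_hcompE hcompD quo_piD.
Qed.

Lemma quo_pi0 : quo_pi 0 = 0.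
Proof. exact: (raddf0 (\pi_quo_sort : {additive M -> quo_sort})). Qed.

Lemma quo_hcomp_id a b u :
  quo_hcomp a (quo_hcomp b u) = if a == b then quo_hcomp b u else 0.
Proof.
have [x ->] := quo_piK u; rewrite !quo_hcompE hcomp_id.
by case: ifP => // _; rewrite quo_pi0.
Qed.

Lemma quo_hcomp_sum u :
  exists2 s : seq A, uniq s & u = \sum_(a <- s) quo_hcomp a u.
Proof.
have [x ->] := quo_piK u; have [s us xE] := hcomp_sum x; exists s => //.
rewrite {1}xE (big_morph quo_pi quo_piD quo_pi0).
by apply: eq_bigr => a _; rewrite quo_hcompE.
Qed.

Lemma quo_hcompC (c : k) a u : quo_hcomp a (c%:MP *: u) = c%:MP *: quo_hcomp a u.
Proof.
by have [x ->] := quo_piK u; rewrite -quo_piZ !quo_hcompE hcompC quo_piZ.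
Qed.

Lemma quo_hcompX j a u : quo_hcomp (w j + a) ('X_j *: u) = 'X_j *: quo_hcomp a u.
Proof.
by have [x ->] := quo_piK u; rewrite -quo_piZ !quo_hcompE hcompX quo_piZ.
Qed.

Definition gquo : gmod k w :=
  GMod quo_hcompD quo_hcomp_id quo_hcomp_sum quo_hcompC quo_hcompX.

End SubmoduleAndQuotient.

Section MonomialIdeal.
Variables (k : fieldType) (n : nat) (A : zmodType) (w : 'I_n -> A).
Local Notation S := {mpoly k[n]}.

Definition reg_hcomp (a : A) (p : S^o) : S^o :=
  \sum_(e <- msupp p | wdeg w e == a) p@_e *: 'X_[e].

Lemma reg_hcompE a p e : (reg_hcomp a p)@_e = if wdeg w e == a then p@_e else 0.
Proof.
rewrite /reg_hcomp raddf_sum /= (eq_bigr (fun f => p@_f * (f == e)%:R)); last first.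
  by move=> f _; rewrite mcoeffZ mcoeffX.
have [ep|ep] := boolP (e \in msupp p); last first.
  rewrite (memN_msupp_eq0 ep) if_same big_seq_cond big1 // => f /andP[fp _].
  by case: eqP fp ep => [->->|_ _ _] //; rewrite mulr0.
rewrite big_mkcond (bigD1_seq e) ?msupp_uniq //= eqxx mulr1 big1 ?addr0 // => f nf.
by case: ifP => // _; rewrite (negbTE nf) mulr0.
Qed.

Lemma reg_hcompD a p q : reg_hcomp a (p + q) = reg_hcomp a p + reg_hcomp a q.
Proof.
apply/mpolyP => e; rewrite mcoeffD !reg_hcompE mcoeffD.
by case: ifP => // _; rewrite addr0.
Qed.

Lemma reg_hcomp_id a b p :
  reg_hcomp a (reg_hcomp b p) = if a == b then reg_hcomp b p else 0.
Proof.
apply/mpolyP => e; case: (eqVneq a b) => [->|nab]; rewrite !reg_hcompE.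
  by case: (wdeg w e == b).
by rewrite mcoeff0; case: eqP => // ->; rewrite (negbTE nab).
Qed.

Lemma reg_hcomp_sum p :
  exists2 s : seq A, uniq s & p = \sum_(a <- s) reg_hcomp a p.
Proof.
exists (undup (map (wdeg w) (msupp p))); first exact: undup_uniq.
apply/mpolyP => e; rewrite raddf_sum /=.
under eq_bigr do rewrite reg_hcompE.
have [ep|ep] := boolP (e \in msupp p); last first.
  by rewrite (memN_msupp_eq0 ep) big1 // => a _; rewrite if_same.
rewrite (bigD1_seq (wdeg w e)) ?undup_uniq ?mem_undup ?map_f //= eqxx.
by rewrite big1 ?addr0 // => a; rewrite eq_sym => /negbTE ->.
Qed.

Lemma reg_hcompC (c : k) a p : reg_hcomp a (c%:MP *: p) = c%:MP *: reg_hcomp a p.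
Proof.
apply/mpolyP => e; rewrite !(reg_hcompE, mcoeffCM).
by case: ifP => // _; rewrite mulr0.
Qed.

Lemma reg_hcompX j a p : reg_hcomp (w j + a) ('X_j *: p) = 'X_j *: reg_hcomp a p.
Proof.
have mX (q : S) (e : 'X_{1..n}) :
    ('X_j * q : S)@_e = if (U_(j) <= e)%MM then q@_(e - U_(j)) else 0.
  case: ifP => [le|nle].
    by rewrite -{1}(submK le) mulrC addmC mcoeffMX.
  apply: memN_msupp_eq0; apply: contraFN nle => /msuppM_le /allpairsP[[u v] /=].
  by rewrite msuppX inE => -[/eqP-> _ ->]; exact: lem_addr.
apply/mpolyP => e; rewrite reg_hcompE !mX reg_hcompE.
case: (boolP (U_(j) <= e)%MM) => [le|_]; last by rewrite if_same.
by rewrite -{1}(submK le) wdegD wdegU addrC (inj_eq (addrI _)).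
Qed.

Definition greg : gmod k w :=
  GMod reg_hcompD reg_hcomp_id reg_hcomp_sum reg_hcompC reg_hcompX.

(* The ideal generated by the monomials x^e with E e.                          *)
Definition monomial_ideal (E : 'X_{1..n} -> Prop) (f : S) : Prop :=
  exists2 s : seq (S * 'X_{1..n}),
    (forall u, u \in s -> E u.2) & f = \sum_(u <- s) u.1 * 'X_[u.2].

Section Ideal.
Variable E : 'X_{1..n} -> Prop.

Definition midl_pred : {pred greg} := fun f : S => `[< monomial_ideal E f >].

Lemma midl_submod : submod_closed midl_pred.
Proof.
split=> [|f p q /asboolP[s sE ->] /asboolP[t tE ->]]; apply/asboolP.
  by exists [::]; rewrite ?big_nil.
exists ([seq (f * u.1, u.2) | u <- s] ++ t).
  by move=> u; rewrite mem_cat => /orP[/mapP[v /sE vE ->]|/tE].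
rewrite big_cat big_map /=; congr (_ + _); rewrite -[LHS]/(f * _) mulr_sumr.
by apply: eq_bigr => u _; rewrite mulrA.
Qed.

HB.instance Definition _ := GRing.isSubmodClosed.Build _ greg midl_pred
  (GRing.submod_closed_semi midl_submod).

Lemma midl_hcomp a (p : greg) : p \in midl_pred -> hcomp a p \in midl_pred.
Proof.
case/asboolP => s sE ->; rewrite (raddf_sum (hcomp (g := greg) a)) /=.
apply/asboolP; exists [seq (reg_hcomp (a - wdeg w u.2) u.1, u.2) | u <- s].
  by move=> u /mapP[v /sE vE ->].
rewrite big_map; apply: eq_bigr => u _ /=.
have := @hcomp_monom k n A w greg u.2 (a - wdeg w u.2) u.1.
rewrite addrC subrK => hE.
by rewrite [u.1 * _]mulrC [RHS]mulrC; exact: hE.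
Qed.

Definition gmideal : hsubmod greg :=
  HSubmod midl_submod midl_hcomp.

End Ideal.
End MonomialIdeal.

Section DirectSum.
Variables (k : fieldType) (n : nat) (A : zmodType) (w : 'I_n -> A).
Variables M N : gmod k w.

Definition dsum_hcomp (a : A) (x : M * N) : M * N := (hcomp a x.1, hcomp a x.2).

Lemma dsum_hcompD a x y : dsum_hcomp a (x + y) = dsum_hcomp a x + dsum_hcomp a y.
Proof. by rewrite /dsum_hcomp !hcompD. Qed.

Lemma dsum_hcomp_id a b x :
  dsum_hcomp a (dsum_hcomp b x) = if a == b then dsum_hcomp b x else 0.
Proof. by rewrite /dsum_hcomp /= !hcomp_id; case: ifP. Qed.

Lemma hcomp_sum_sub (L : gmod k w) (x : L) (s t : seq A) :
  uniq s -> uniq t -> {subset s <= t} -> x = \sum_(a <- s) hcomp a x ->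
  x = \sum_(a <- t) hcomp a x.
Proof.
move=> us ut st xE.
have x0 a : a \notin s -> hcomp a x = 0.
  move=> nas; rewrite xE (raddf_sum (hcomp a)) big_seq big1 // => b bs.
  by rewrite /= hcomp_id; case: eqP => // ab; rewrite ab bs in nas.
rewrite [LHS]xE [RHS](bigID (mem s)) /= [X in _ = _ + X]big1 ?addr0 => [|a /x0 //].
rewrite -[RHS]big_filter; apply: perm_big; apply: uniq_perm; rewrite ?filter_uniq //.
by move=> a; rewrite mem_filter; case: (boolP (a \in s)) => // /st ->.
Qed.

Lemma dsum_hcomp_sum x :
  exists2 s : seq A, uniq s & x = \sum_(a <- s) dsum_hcomp a x.
Proof.
have [s us sE] := hcomp_sum x.1; have [t ut tE] := hcomp_sum x.2.
exists (undup (s ++ t)); first exact: undup_uniq.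
have ss a : a \in s -> a \in undup (s ++ t) by rewrite mem_undup mem_cat => ->.
have tt a : a \in t -> a \in undup (s ++ t) by rewrite mem_undup mem_cat orbC => ->.
have h1 : (\sum_(a <- undup (s ++ t)) dsum_hcomp a x).1
          = \sum_(a <- undup (s ++ t)) hcomp a x.1.
  exact: (big_morph fst).
have h2 : (\sum_(a <- undup (s ++ t)) dsum_hcomp a x).2
          = \sum_(a <- undup (s ++ t)) hcomp a x.2.
  exact: (big_morph snd).
rewrite [LHS]surjective_pairing [RHS]surjective_pairing h1 h2.
by congr (_, _); [apply: (hcomp_sum_sub us)|apply: (hcomp_sum_sub ut)];
  rewrite ?undup_uniq.
Qed.

Lemma dsum_hcompC (c : k) a x : dsum_hcomp a (c%:MP *: x) = c%:MP *: dsum_hcomp a x.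
Proof. by rewrite /dsum_hcomp /= !hcompC. Qed.

Lemma dsum_hcompX j a x : dsum_hcomp (w j + a) ('X_j *: x) = 'X_j *: dsum_hcomp a x.
Proof. by rewrite /dsum_hcomp /= !hcompX. Qed.

Definition gdsum : gmod k w :=
  GMod dsum_hcompD dsum_hcomp_id dsum_hcomp_sum dsum_hcompC dsum_hcompX.

End DirectSum.

(* H^q_a(M), for a the ideal generated by the monomials x^e with E e, as the   *)
(* cohomology of \Gamma_a(I^0) -> \Gamma_a(I^1) -> ... for an injective        *)
(* resolution I of M in the category of graded modules; this is what gives     *)
(* H^q_a(M) its grading.                                                       *)
Section LocalCohomology.
Variables (k : fieldType) (n : nat) (A : zmodType) (w : 'I_n -> A).
Local Notation S := {mpoly k[n]}.
Variable E : 'X_{1..n} -> Prop.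
Local Notation a := (@monomial_ideal k n E).

(* x belongs to \Gamma_a(M) when some power a^t kills x; a^t is generated by   *)
(* the products of t elements of a.                                            *)
Definition torsion (M : gmod k w) (x : M) : Prop :=
  exists t : nat, forall fs : seq S, size fs = t ->
    (forall f, f \in fs -> a f) -> (\prod_(f <- fs) f) *: x = 0.

Lemma torsion0 (M : gmod k w) : torsion (0 : M).
Proof. by exists 0%N => fs _ _; rewrite scaler0. Qed.

Lemma torsionP (M : gmod k w) c (x y : M) :
  torsion x -> torsion y -> torsion (c *: x + y).
Proof.
move=> [t tx] [u uy]; exists (t + u)%N => fs sfs afs.
have tfs : size (take t fs) = t by rewrite size_takel ?sfs ?leq_addr.
have dfs : size (drop t fs) = u by rewrite size_drop sfs addKn.
rewrite -(cat_take_drop t fs) big_cat /= scalerDr.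
rewrite -[_ *: y]scalerA uy => [|//|f /mem_drop /afs //].
rewrite scalerA mulrC [X in c * X]mulrC mulrA -scalerA tx => [|//|f /mem_take /afs //].
by rewrite !scaler0 addr0.
Qed.

Lemma torsion_monom (M : gmod k w) t (x : M) :
  (forall es : seq 'X_{1..n}, size es = t -> (forall e, e \in es -> E e) ->
     'X_[\big[mnm_add/0%MM]_(e <- es) e] *: x = 0) ->
  forall fs : seq S, size fs = t -> (forall f, f \in fs -> a f) ->
    (\prod_(f <- fs) f) *: x = 0.
Proof.
elim: t x => [|t IHt] x hx [|f fs] //= => [_ _|[sfs] afs].
  by move: (hx [::] erefl); rewrite !big_nil mpolyX0; apply.
have [s sE fE] := afs f (mem_head _ _).
rewrite big_cons fE mulr_suml scaler_suml big_seq big1 // => u us.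
rewrite -!mulrA -scalerA mulrC -scalerA IHt ?scaler0 // => [es ses Ees|g gfs].
  rewrite scalerA -mpolyXD.
  have := hx (u.2 :: es); rewrite /= ses big_cons addmC; apply=> // e.
  by rewrite inE => /orP[/eqP ->|/Ees //]; exact: sE.
by apply: afs; rewrite inE gfs orbT.
Qed.

Lemma torsion_hcomp (M : gmod k w) b (x : M) : torsion x -> torsion (hcomp b x).
Proof.
case=> t tx; exists t; apply: torsion_monom => es ses Ees.
rewrite -hcomp_monom (_ : _ *: x = 0) ?raddf0 //.
have Xm : 'X_[\big[mnm_add/0%MM]_(e <- es) e] = \prod_(e <- es) 'X_[e] :> S.
  by apply: (big_morph (fun e => 'X_[e] : S)); [exact: mpolyXD|exact: mpolyX0].
rewrite Xm -(big_map (fun e => 'X_[e] : S) xpredT id); apply: tx.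
  by rewrite size_map.
move=> f /mapP[e /Ees Ee ->]; exists [:: (1, e)].
  by move=> u; rewrite inE => /eqP ->.
by rewrite big_seq1 mul1r.
Qed.

Variables (M : gmod k w) (R : ginjective_resolution M) (q : nat).

Definition cocycle_pred : {pred res_mod R q} :=
  fun x => `[< torsion x /\ res_diff R q x = 0 >].

Lemma cocycle_closed : submod_closed cocycle_pred.
Proof.
split=> [|c x y /asboolP[tx dx] /asboolP[ty dy]]; apply/asboolP.
  by split; [exact: torsion0|rewrite raddf0].
by split; [exact: torsionP|rewrite linearP dx dy scaler0 addr0].
Qed.

Lemma cocycle_hcomp b x : x \in cocycle_pred -> hcomp b x \in cocycle_pred.
Proof.
move=> /asboolP[tx dx]; apply/asboolP.
by split; [exact: torsion_hcomp|rewrite ghom_hcomp dx raddf0].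
Qed.

Definition cocycles : gmod k w := gsub (HSubmod cocycle_closed cocycle_hcomp).

Definition is_coboundary (p : nat) : res_mod R p -> Prop :=
  match p return res_mod R p -> Prop with
  | 0 => fun x => x = 0
  | p'.+1 => fun x => exists2 y, torsion y & res_diff R p' y = x
  end.

Definition coboundary_pred : {pred cocycles} :=
  fun z => `[< is_coboundary (val z) >].

Lemma coboundary_closed : submod_closed coboundary_pred.
Proof.
split=> [|c x y /asboolP /= bx /asboolP /= by_]; apply/asboolP => /=.
  case: (q) => [|p] //=; exists 0; [exact: torsion0|exact: raddf0].
move: (val x) (val y) bx by_; case: (q) => [|p] /= u v.
  by move=> -> ->; rewrite scaler0 addr0.
move=> [y' ty' <-] [z' tz' <-]; exists (c *: y' + z'); first exact: torsionP.
by rewrite linearP.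
Qed.

Lemma coboundary_hcomp b x : x \in coboundary_pred -> hcomp b x \in coboundary_pred.
Proof.
move=> /asboolP /= bx; apply/asboolP => /=.
move: (val x) bx; case: (q) => [|p] u /=; first by move=> ->; rewrite raddf0.
move=> [y ty <-]; exists (hcomp b y); first exact: torsion_hcomp.
by rewrite ghom_hcomp.
Qed.

Definition local_cohomology : gmod k w :=
  gquo (HSubmod coboundary_closed coboundary_hcomp).

End LocalCohomology.

Definition fine_deg (n : nat) (j : 'I_n) : {ffun 'I_n -> int} :=
  [ffun l => (l == j)%:R].

Section StanleyReisner.
Variable n : nat.
Implicit Type D : {set {set 'I_n}}.

Definition is_complex D : Prop :=
  forall s t : {set 'I_n}, s \in D -> t \subset s -> t \in D.

Definition has_all_vertices D : Prop := forall j : 'I_n, [set j] \in D.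

Definition sqfree (t : {set 'I_n}) : 'X_{1..n} := [multinom (j \in t : nat) | j < n].

Definition nonface_monomial D (e : 'X_{1..n}) : Prop :=
  exists2 t : {set 'I_n}, t \notin D & e = sqfree t.

Definition stanley_reisner (k : fieldType) D : gmod k (@fine_deg n) :=
  gquo (gmideal k (@fine_deg n) (nonface_monomial D)).

Definition deletion (i : 'I_n) D : {set {set 'I_n}} := [set t in D | i \notin t].

Definition link (i : 'I_n) D : {set {set 'I_n}} :=
  [set t : {set 'I_n} | (i \notin t) && (i |: t \in D)].

(* lift i : 'I_n.-1 -> 'I_n identifies the variables of {mpoly k[n.-1]} with   *)
(* the elements of [n] \ {i}.                                                  *)
Definition on_complement (i : 'I_n) D : {set {set 'I_n.-1}} :=
  [set s : {set 'I_n.-1} | lift i @: s \in D].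

End StanleyReisner.

(* Exponents of the monomials generating p_i = (x_j : j != i), resp. the        *)
(* maximal graded ideal (x_1, ..., x_n).                                       *)
Definition vertex_prime (n : nat) (i : 'I_n) (e : 'X_{1..n}) : Prop :=
  exists2 j : 'I_n, j != i & e = U_(j)%MM.

Definition max_ideal (n : nat) (e : 'X_{1..n}) : Prop := exists j, e = U_(j)%MM.

Section Degrees.
Variables (n : nat) (i : 'I_n).
Local Notation A := {ffun 'I_n -> int}.
Local Notation A' := {ffun 'I_n.-1 -> int}.

(* The degree a = (c; b) with a_i = c, and the component b of a.               *)
Definition deg_join (c : int) (b : A') : A :=
  [ffun l => if unlift i l is Some j then b j else c].

Definition deg_rest (a : A) : A' := [ffun j => a (lift i j)].

Lemma deg_rest_join c b : deg_rest (deg_join c b) = b.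
Proof. by apply/ffunP => j; rewrite !ffunE liftK. Qed.

Lemma deg_joinE c b : deg_join c b i = c.
Proof. by rewrite ffunE unlift_none. Qed.

Lemma deg_join_rest (a : A) : deg_join (a i) (deg_rest a) = a.
Proof.
by apply/ffunP => l; rewrite ffunE; case: unliftP => [j ->|->] //; rewrite ffunE.
Qed.

Lemma deg_eq (a b : A) : (a == b) = (a i == b i) && (deg_rest a == deg_rest b).
Proof.
apply/eqP/andP => [-> //|[/eqP ab /eqP rab]].
by rewrite -(deg_join_rest a) -(deg_join_rest b) ab rab.
Qed.

(* The degree of x_j for j != i, in the Z^n-grading of S'.                     *)
Definition sub_deg (j : 'I_n.-1) : A := fine_deg (lift i j).

Lemma sub_deg_i j (a : A) : (sub_deg j + a) i = a i.
Proof. by rewrite !ffunE (negbTE (neq_lift _ _)) add0r. Qed.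

Lemma sub_deg_rest j (a : A) : deg_rest (sub_deg j + a) = fine_deg j + deg_rest a.
Proof. by apply/ffunP => l; rewrite !ffunE (inj_eq lift_inj). Qed.

End Degrees.

Section RestrictionOfScalars.
Variables (k : fieldType) (n : nat) (i : 'I_n).

Definition sub_incl : {mpoly k[n.-1]} -> {mpoly k[n]} :=
  mmap (@mpolyC n k) (fun j => 'X_(lift i j)).

HB.instance Definition _ := GRing.RMorphism.on sub_incl.

Variable M : gmod k (@fine_deg n).

Definition res_sort : Type := M.
HB.instance Definition _ := GRing.Zmodule.on res_sort.

Definition res_scale (s : {mpoly k[n.-1]}) (x : res_sort) : res_sort :=
  sub_incl s *: (x : M).

Lemma res_scaleA s t x : res_scale s (res_scale t x) = res_scale (s * t) x.
Proof. by rewrite /res_scale scalerA rmorphM. Qed.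

Lemma res_scale1 : left_id 1 res_scale.
Proof. by move=> x; rewrite /res_scale rmorph1 scale1r. Qed.

Lemma res_scaleDr : right_distributive res_scale +%R.
Proof. by move=> s x y; rewrite /res_scale scalerDr. Qed.

Lemma res_scaleDl x : {morph res_scale^~ x : s t / s + t}.
Proof. by move=> s t; rewrite /res_scale rmorphD scalerDl. Qed.

HB.instance Definition _ := GRing.Zmodule_isLmodule.Build {mpoly k[n.-1]} res_sort
  res_scaleA res_scale1 res_scaleDr res_scaleDl.

Definition res_hcomp (a : {ffun 'I_n -> int}) (x : res_sort) : res_sort :=
  hcomp a (x : M).

Lemma res_hcompC (c : k) a x : res_hcomp a (c%:MP *: x) = c%:MP *: res_hcomp a x.
Proof.
by rewrite -[LHS]/(hcomp a (sub_incl c%:MP *: (x : M))) /sub_incl mmapC hcompC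
           -[RHS]/(sub_incl c%:MP *: (hcomp a (x : M))) /sub_incl mmapC.
Qed.

Lemma res_hcompX j a x :
  res_hcomp (sub_deg i j + a) ('X_j *: x) = 'X_j *: res_hcomp a x.
Proof.
by rewrite -[LHS]/(hcomp _ (sub_incl 'X_j *: (x : M))) /sub_incl mmapX mmap1U hcompX
           -[RHS]/(sub_incl 'X_j *: (hcomp a (x : M))) /sub_incl mmapX mmap1U.
Qed.

(* M as a Z^n-graded S'-module, for S' = k[x_j : j != i].                      *)
Definition restrict : gmod k (sub_deg i) :=
  @GMod k n.-1 _ (sub_deg i) res_sort res_hcomp (@hcompD _ _ _ _ M)
    (@hcomp_id _ _ _ _ M) (@hcomp_sum _ _ _ _ M) res_hcompC res_hcompX.

End RestrictionOfScalars.

Section InDegreeZero.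
Variables (k : fieldType) (n : nat) (i : 'I_n) (H : gmod k (@fine_deg n.-1)).
Local Notation A := {ffun 'I_n -> int}.

Definition deg0_hcomp (a : A) (x : H) : H :=
  if a i == 0 then hcomp (deg_rest i a) x else 0.

Lemma deg0_hcompD a x y : deg0_hcomp a (x + y) = deg0_hcomp a x + deg0_hcomp a y.
Proof. by rewrite /deg0_hcomp; case: ifP => _; rewrite ?addr0 // hcompD. Qed.

Lemma deg0_hcomp_id a b x :
  deg0_hcomp a (deg0_hcomp b x) = if a == b then deg0_hcomp b x else 0.
Proof.
rewrite /deg0_hcomp (deg_eq i); case: (eqVneq (b i) 0) => [->|nb].
  by case: eqP => //= _; rewrite hcomp_id.
by rewrite raddf0 !if_same.
Qed.

Lemma deg0_hcomp_sum x : exists2 s : seq A, uniq s & x = \sum_(a <- s) deg0_hcomp a x.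
Proof.
have [s us xE] := hcomp_sum x; exists (map (deg_join i 0) s).
  by rewrite map_inj_uniq // => b c /(congr1 (deg_rest i)); rewrite !deg_rest_join.
rewrite big_map {1}xE; apply: eq_bigr => b _.
by rewrite /deg0_hcomp deg_joinE eqxx deg_rest_join.
Qed.

Lemma deg0_hcompC (c : k) a x : deg0_hcomp a (c%:MP *: x) = c%:MP *: deg0_hcomp a x.
Proof. by rewrite /deg0_hcomp; case: ifP; rewrite ?hcompC ?scaler0. Qed.

Lemma deg0_hcompX j a x :
  deg0_hcomp (sub_deg i j + a) ('X_j *: x) = 'X_j *: deg0_hcomp a x.
Proof.
rewrite /deg0_hcomp sub_deg_i sub_deg_rest.
by case: ifP; rewrite ?hcompX ?scaler0.
Qed.

(* H placed in x_i-degree 0.                                                   *)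
Definition in_deg0 : gmod k (sub_deg i) :=
  GMod deg0_hcompD deg0_hcomp_id deg0_hcomp_sum deg0_hcompC deg0_hcompX.

End InDegreeZero.

(* H \otimes_k x_i k[x_i] = \bigoplus_{c >= 1} H \otimes x_i^c, realized as    *)
(* the S'-module of finitely supported families (h_c)_c with h_0 = 0, where    *)
(* h_c stands for h_c \otimes x_i^c; see tensor_xk_universal.                  *)
Section TensorXK.
Variables (k : fieldType) (n : nat) (i : 'I_n) (H : gmod k (@fine_deg n.-1)).
Local Notation S' := {mpoly k[n.-1]}.
Local Notation A := {ffun 'I_n -> int}.

Definition txk_pred : {pred nat -> H} :=
  fun h => `[< h 0%N = 0 /\ exists N, forall c, (N < c)%N -> h c = 0 >].

Lemma txk_closed : submod_closed txk_pred.
Proof.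
split=> [|s g h /asboolP[g0 [N gN]] /asboolP[h0 [K hK]]]; apply/asboolP.
  by split=> //; exists 0%N.
rewrite -[(s *: g + h) 0%N]/(s *: g 0%N + h 0%N) g0 h0 scaler0 addr0; split=> //.
exists (maxn N K) => c; rewrite gtn_max => /andP[Nc Kc].
by rewrite -[LHS]/(s *: g c + h c) gN ?hK // scaler0 addr0.
Qed.

HB.instance Definition _ := GRing.isSubmodClosed.Build _ _ txk_pred
  (GRing.submod_closed_semi txk_closed).

Definition txk_sort := {h : nat -> H | h \in txk_pred}.
HB.instance Definition _ := SubChoice.on txk_sort.
HB.instance Definition _ := [SubChoice_isSubLmodule of txk_sort by <:].

Lemma txk_eq (g h : txk_sort) : (forall c, val g c = val h c) -> g = h.
Proof. by move=> gh; apply/val_inj/funext. Qed.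

Lemma txk_hcomp_subproof (a : A) (h : txk_sort) :
  (fun c : nat => if a i == c%:Z then hcomp (deg_rest i a) (val h c) else 0)
    \in txk_pred.
Proof.
have /asboolP[h0 [N hN]] := valP h; apply/asboolP; split.
  by rewrite h0; case: ifP => // _; exact: raddf0.
by exists N => c /hN ->; case: ifP => // _; exact: raddf0.
Qed.

Definition txk_hcomp (a : A) (h : txk_sort) : txk_sort :=
  exist (fun g => g \in txk_pred) _ (txk_hcomp_subproof a h).

Lemma txk_hcompE a h c :
  val (txk_hcomp a h) c = if a i == c%:Z then hcomp (deg_rest i a) (val h c) else 0.
Proof. by []. Qed.

Lemma txk_valD (g h : txk_sort) c : val (g + h) c = val g c + val h c.
Proof. by []. Qed.

Lemma txk_valZ s (h : txk_sort) c : val (s *: h) c = s *: val h c.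
Proof. by []. Qed.

Lemma txk_val0 c : val (0 : txk_sort) c = 0.
Proof. by []. Qed.

Lemma txk_val_sum (I : Type) (s : seq I) (P : pred I) (F : I -> txk_sort) c :
  val (\sum_(j <- s | P j) F j) c = \sum_(j <- s | P j) val (F j) c.
Proof. by elim/big_rec2: _ => [|j x y _ <-]; rewrite ?txk_val0 ?txk_valD. Qed.

Lemma txk_hcompD a g h : txk_hcomp a (g + h) = txk_hcomp a g + txk_hcomp a h.
Proof.
apply: txk_eq => c; rewrite txk_valD !txk_hcompE txk_valD.
by case: ifP => _; rewrite ?addr0 // hcompD.
Qed.

Lemma txk_hcomp_id a b h :
  txk_hcomp a (txk_hcomp b h) = if a == b then txk_hcomp b h else 0.
Proof.
apply: txk_eq => c; rewrite !txk_hcompE (deg_eq i a b).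
case: (eqVneq (b i) c%:Z) => [bc|nbc]; last first.
  rewrite raddf0 if_same; case: ifP => _ //.
  by rewrite txk_hcompE (negbTE nbc).
rewrite hcomp_id bc; case: (a i == c%:Z) => //=; case: ifP => // _.
by rewrite txk_hcompE bc eqxx.
Qed.

Lemma txk_hcomp_sum h : exists2 s : seq A, uniq s & h = \sum_(a <- s) txk_hcomp a h.
Proof.
have /asboolP[h0 [N hN]] := valP h.
have [t ut tE] : exists2 t : seq {ffun 'I_n.-1 -> int}, uniq t &
    forall c, (c <= N)%N -> val h c = \sum_(b <- t) hcomp b (val h c).
  elim: N {hN} => [|N [t ut tE]].
    by exists [::] => // c; rewrite leqn0 => /eqP ->; rewrite big_nil.
  have [s us sE] := hcomp_sum (val h N.+1).
  exists (undup (s ++ t)); first exact: undup_uniq.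
  move=> c; rewrite leq_eqVlt => /orP[/eqP ->|/tE cE].
    apply: (hcomp_sum_sub us) => //; rewrite ?undup_uniq // => a.
    by rewrite mem_undup mem_cat => ->.
  apply: (hcomp_sum_sub ut) => //; rewrite ?undup_uniq // => a.
  by rewrite mem_undup mem_cat orbC => ->.
exists [seq deg_join i c%:Z b | c : nat <- iota 0 N.+1, b <- t].
  apply: allpairs_uniq => //; first exact: iota_uniq.
  move=> [c b] [c' b'] _ _ /= e; congr (_, _).
    by have := congr1 (fun a : A => a i) e; rewrite /= !deg_joinE => -[].
  by have := congr1 (deg_rest i) e; rewrite !deg_rest_join.
apply: txk_eq => c; rewrite txk_val_sum big_allpairs_dep.
under eq_bigr => d _ do under eq_bigr => b _ do
  rewrite txk_hcompE deg_joinE deg_rest_join.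
have [cN|Nc] := leqP c N; last first.
  by rewrite hN // big1 // => d _; rewrite big1 // => b _; rewrite raddf0 if_same.
rewrite (bigD1_seq c) ?iota_uniq ?mem_iota //= [X in _ + X]big1 => [|d ndc].
  by rewrite addr0 {1}tE //; apply: eq_bigr => b _; rewrite eqxx.
by rewrite big1 // => b _; rewrite eqz_nat (negbTE ndc).
Qed.

Lemma txk_hcompC (c : k) a h : txk_hcomp a (c%:MP *: h) = c%:MP *: txk_hcomp a h.
Proof.
apply: txk_eq => d; rewrite txk_valZ !txk_hcompE txk_valZ.
by case: ifP => _; rewrite ?scaler0 // hcompC.
Qed.

Lemma txk_hcompX j a h :
  txk_hcomp (sub_deg i j + a) ('X_j *: h) = 'X_j *: txk_hcomp a h.
Proof.
apply: txk_eq => d; rewrite txk_valZ !txk_hcompE txk_valZ sub_deg_i sub_deg_rest.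
by case: ifP => _; rewrite ?scaler0 // hcompX.
Qed.

Definition tensor_xk : gmod k (sub_deg i) :=
  GMod txk_hcompD txk_hcomp_id txk_hcomp_sum txk_hcompC txk_hcompX.

Lemma pure_xk_subproof (x : H) (p : {poly k}) :
  (fun c : nat => if c == 0%N then 0 else (p`_c)%:MP *: x) \in txk_pred.
Proof.
apply/asboolP; split=> //; exists (size p) => c pc.
by case: eqP => // _; rewrite nth_default ?mpolyC0 ?scale0r // ltnW.
Qed.

(* h \otimes p, for p in x_i k[x_i].                                           *)
Definition pure_xk (x : H) (p : {poly k}) : tensor_xk :=
  exist (fun g => g \in txk_pred) _ (pure_xk_subproof x p).

Lemma pure_xkE x p c :
  val (pure_xk x p : txk_sort) c = if c == 0%N then 0 else (p`_c)%:MP *: x.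
Proof. by []. Qed.

Definition xk_bilinear (P : lmodType S') (b : H -> {poly k} -> P) : Prop :=
  [/\ forall s x y (p : {poly k}), p`_0 = 0 -> b (s *: x + y) p = s *: b x p + b y p
    & forall c x (p r : {poly k}), p`_0 = 0 -> r`_0 = 0 ->
        b x (c *: p + r) = c%:MP *: b x p + b x r].

Lemma pure_xk_bilinear : xk_bilinear pure_xk.
Proof.
split=> [s x y p p0|c x p r p0 r0]; apply: txk_eq => d.
  rewrite txk_valD txk_valZ !pure_xkE; case: eqP => _; first by rewrite scaler0 addr0.
  by rewrite scalerDr !scalerA mulrC.
rewrite txk_valD txk_valZ !pure_xkE; case: eqP => _; first by rewrite scaler0 addr0.
by rewrite coefD coefZ mpolyCD mpolyCM scalerDl scalerA.
Qed.

Lemma xk_coefXn0 c : (('X^(c.+1) : {poly k}))`_0 = 0.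
Proof. by rewrite coefXn. Qed.

Lemma txk_decomp (h : txk_sort) N : (forall c, (N < c)%N -> val h c = 0) ->
  h = \sum_(c < N) pure_xk (val h c.+1) 'X^(c.+1).
Proof.
move=> hN; have /asboolP[h0 _] := valP h; apply: txk_eq => d.
rewrite txk_val_sum; under eq_bigr do rewrite pure_xkE coefXn.
case: d => [|d]; first by rewrite big1.
have [dN|Nd] := ltnP d N; last first.
  rewrite hN // big1 // => c _ /=; rewrite eqSS gtn_eqF ?mpolyC0 ?scale0r //.
  exact: leq_trans (ltn_ord c) Nd.
rewrite (bigD1 (Ordinal dN)) //= eqxx mpolyC1 scale1r big1 ?addr0 // => c ncd.
by rewrite eqSS eq_sym -[d]/(val (Ordinal dN)) val_eqE (negbTE ncd) mpolyC0 scale0r.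
Qed.

Lemma tensor_xk_universal (P : lmodType S') (b : H -> {poly k} -> P) :
  xk_bilinear b ->
  exists2 g : {linear tensor_xk -> P},
    (forall x (p : {poly k}), p`_0 = 0 -> g (pure_xk x p) = b x p) &
    forall g' : {linear tensor_xk -> P},
      (forall x (p : {poly k}), p`_0 = 0 -> g' (pure_xk x p) = b x p) -> g' =1 g.
Proof.
move=> [bl br].
have b0l (p : {poly k}) : p`_0 = 0 -> b 0 p = 0.
  by move=> p0; have := bl (-1) 0 0 p p0; rewrite scaler0 addr0 scaleN1r addNr.
have b0r x : b x 0 = 0.
  have := br (-1) x 0 0 (coef0 _ _) (coef0 _ _).
  by rewrite scaler0 addr0 mpolyCN mpolyC1 scaleN1r addNr.
pose bd (h : txk_sort) N := forall c, (N < c)%N -> val h c = 0.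
have exbd h : exists N, bd h N by have /asboolP[_ ?] := valP h.
pose F (h : txk_sort) N := \sum_(c < N) b (val h c.+1) 'X^(c.+1).
have FE h N K : bd h N -> (N <= K)%N -> F h K = F h N.
  move=> hN NK; rewrite /F (big_ord_widen _ (fun c => b (val h c.+1) 'X^(c.+1)) NK).
  rewrite [RHS]big_mkcond; apply: eq_bigr => c _; case: ltnP => // Nc.
  by rewrite hN // b0l ?xk_coefXn0.
pose g h := F h (projT1 (cid (exbd h))).
have gE h N : bd h N -> g h = F h N.
  move=> hN; rewrite /g; case: (cid _) => K /= hK.
  by case/orP: (leq_total N K) => le; [exact: FE|symmetry; exact: FE].
have gl : linear g.
  move=> s x y; have [N xN] := exbd x; have [K yK] := exbd y.
  pose m := maxn N K.
  have xm : bd x m by move=> c; rewrite gtn_max => /andP[/xN].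
  have ym : bd y m by move=> c; rewrite gtn_max => /andP[_ /yK].
  have xym : bd (s *: x + y) m.
    by move=> c mc; rewrite txk_valD txk_valZ xm // ym // scaler0 addr0.
  rewrite (gE _ _ xm) (gE _ _ ym) (gE _ _ xym) /F scaler_sumr -big_split.
  by apply: eq_bigr => c _; rewrite txk_valD txk_valZ bl ?xk_coefXn0.
pose gL := GRing.isLinear.Build _ _ _ _ g gl.
pose G : {linear tensor_xk -> P} := HB.pack g gL.
have GE x (p : {poly k}) : p`_0 = 0 -> G (pure_xk x p) = b x p.
  move=> p0; have pb : bd (pure_xk x p) (size p).
    by move=> c pc; rewrite pure_xkE; case: eqP => // _;
      rewrite nth_default ?mpolyC0 ?scale0r // ltnW.
  rewrite -[LHS]/(g _) (gE _ _ pb) /F.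
  under eq_bigr => c _.
    rewrite pure_xkE /= -[_ *: x]addr0 bl ?xk_coefXn0 // b0l ?xk_coefXn0 // addr0.
    rewrite -[_ *: b _ _]addr0 -(b0r x) -br ?xk_coefXn0 ?coef0 // addr0.
    over.
  have bsum (I : Type) (s : seq I) (Q : I -> {poly k}) : (forall j, (Q j)`_0 = 0) ->
      \sum_(j <- s) b x (Q j) = b x (\sum_(j <- s) Q j) /\ (\sum_(j <- s) Q j)`_0 = 0.
    move=> Q0; elim: s => [|j s [IH IH0]]; first by rewrite !big_nil b0r coef0.
    rewrite !big_cons coefD Q0 IH0 addr0 IH; split=> //.
    by rewrite -[Q j]scale1r br // mpolyC1 !scale1r.
  have [|-> _] := bsum _ (index_enum 'I_(size p)) (fun c => p`_c.+1 *: 'X^(c.+1)).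
    by move=> c; rewrite coefZ xk_coefXn0 mulr0.
  congr (b x _); apply/polyP => d; rewrite coef_sum.
  under eq_bigr do rewrite coefZ coefXn.
  case: d => [|d]; first by rewrite p0 big1 // => c _; rewrite mulr0.
  have [dN|Nd] := ltnP d (size p); last first.
    rewrite nth_default 1?ltnW // big1 // => c _.
    by rewrite eqSS gtn_eqF ?mulr0 // (leq_trans (ltn_ord c)).
  rewrite (bigD1 (Ordinal dN)) //= eqxx mulr1 big1 ?addr0 // => c ncd.
  by rewrite eqSS eq_sym -[d]/(val (Ordinal dN)) val_eqE (negbTE ncd) mulr0.
exists G => // G' G'E h; have [N hN] := exbd h.
rewrite (txk_decomp hN) !raddf_sum; apply: eq_bigr => c _.
by apply: etrans (G'E _ _ (xk_coefXn0 c)) (esym (GE _ _ (xk_coefXn0 c))).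
Qed.

End TensorXK.

(* The homogeneous component M_a as a k-vector space.                          *)
Section Component.
Variables (k : fieldType) (n : nat) (A : zmodType) (w : 'I_n -> A) (M : gmod k w).

Definition kmod : Type := M.
HB.instance Definition _ := GRing.Zmodule.on kmod.

Definition kscale (c : k) (x : kmod) : kmod := c%:MP *: (x : M).

Lemma kscaleA c d x : kscale c (kscale d x) = kscale (c * d) x.
Proof. by rewrite /kscale scalerA mpolyCM. Qed.

Lemma kscale1 : left_id 1 kscale.
Proof. by move=> x; rewrite /kscale mpolyC1 scale1r. Qed.

Lemma kscaleDr : right_distributive kscale +%R.
Proof. by move=> c x y; rewrite /kscale scalerDr. Qed.

Lemma kscaleDl x : {morph kscale^~ x : c d / c + d}.
Proof. by move=> c d; rewrite /kscale mpolyCD scalerDl. Qed.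

HB.instance Definition _ := GRing.Zmodule_isLmodule.Build k kmod
  kscaleA kscale1 kscaleDr kscaleDl.

Variable a : A.

Definition homog_pred : {pred kmod} := fun x => hcomp a (x : M) == x.

Lemma homog_closed : submod_closed homog_pred.
Proof.
split=> [|c x y /eqP hx /eqP hy]; apply/eqP; first exact: (raddf0 (hcomp (g := M) a)).
by rewrite (raddfD (hcomp (g := M) a)) [in LHS]/= hcompC hx hy.
Qed.

HB.instance Definition _ := GRing.isSubmodClosed.Build k kmod homog_pred
  (GRing.submod_closed_semi homog_closed).

Definition component := {x : kmod | x \in homog_pred}.
HB.instance Definition _ := SubChoice.on component.
HB.instance Definition _ := [SubChoice_isSubLmodule of component by <:].

End Component.

Definition linear_iso (k : fieldType) (U V : lmodType k) : Prop :=
  exists f : {linear U -> V}, bijective f.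

(* Main.v *)
(* Taking the part M_(c; _) of x_i-degree c is an exact functor from
   Z^n-graded S-modules to Z^(n-1)-graded S'-modules. Its left adjoint
   N |-> N \otimes_k x_i^c k[x_i] is exact as well, so the functor preserves
   injectives; it also commutes with torsion, since p_i is generated by the
   variables of S'. Hence it turns a resolution R of k[Delta] into an injective
   resolution of k[Delta]_(c; _), and H^q_(p_i)(k[Delta])_(c; _) is
   H^q_m'(k[Delta]_(c; _)). Finally k[Delta]_(c; _) is k[del] for c = 0, k[lk]
   for c >= 1 and 0 for c < 0, as x_i^c x^e is nonzero in k[Delta] exactly when
   the support of x_i^c x^e is a face. *)
Require Import Defs.
From HB Require Import structures.
From mathcomp Require Import all_boot all_order all_algebra.
From mathcomp Require Import boolp.
From mathcomp Require Import mpoly ring.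

Set Implicit Arguments.
Unset Strict Implicit.
Unset Printing Implicit Defensive.
Import Order.TTheory GRing.Theory Num.Theory.
Local Open Scope ring_scope.

(** The resolutions [R], [Rdel] and [Rlk] are arbitrary, so the slice of [R] only resolves a module
    isomorphic to the one that [Rdel] or [Rlk] resolves. Comparison of injective resolutions up to
    homotopy bridges this gap: a linear map preserves torsion, so lifts and homotopies restrict to
    the complexes of torsion elements. The same argument makes the local cohomology of the zero
    module vanish, which settles c < 0. Elements of cohomology and of k[Delta] are reached only
    through representatives. Isomorphisms are therefore built from linear relations between elements
    that share a representative. A class of x_i-degree c may have a representative with components
    of other x_i-degrees; it is replaced by its x_i-degree c part, a finite sum of homogeneous
    components, which are again torsion cocycles. Isomorphisms of the single slices must still be
    glued into one isomorphism over S'. This works because every element has finitely many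
    components, so that its slices form a finitely supported family. *)

Lemma mpoly_generators_ind (k : fieldType) (n : nat) (P : {mpoly k[n]} -> Prop) :
  (forall c, P c%:MP) -> (forall p q, P p -> P q -> P (p + q)) ->
  (forall j p, P p -> P ('X_j * p)) -> forall p, P p.
Proof.
move=> PC PD PX; elim/mpolyind => [|c m p _ _ Pp]; first by rewrite -mpolyC0.
apply: PD => //; rewrite -mul_mpolyC mpolyXE_id mulrC.
elim: (index_enum _) => [|j s IHs]; first by rewrite big_nil mul1r.
rewrite big_cons; elim: (m j) => [|e IHe]; first by rewrite expr0 mul1r.
by rewrite exprS -!mulrA; apply: PX; rewrite !mulrA in IHe *.
Qed.

(** * Graded homomorphisms and extension into injectives *)

Section GradedModules.
Variables (k : fieldType) (n : nat) (A : zmodType) (w : 'I_n -> A).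
Implicit Types M N L I : gmod k w.

Lemma hcompX_sub M j a (x : M) : hcomp a ('X_j *: x) = 'X_j *: hcomp (a - w j) x.
Proof. by rewrite -hcompX addrC subrK. Qed.

Lemma hcomp_ext M (x y : M) : (forall a, hcomp a x = hcomp a y) -> x = y.
Proof.
move=> xy; apply/eqP; rewrite -subr_eq0; have [s _ ->] := hcomp_sum (x - y).
by rewrite big1 // => a _; rewrite raddfB /= xy subrr.
Qed.

(** The ring maps behind the module structures below ([sub_incl], [to_poly]) compute readily on
    constants and variables only. These generate the ring, so linearity may be checked on them. *)
Lemma linear_of_generators (U V : lmodType {mpoly k[n]}) (f : U -> V) :
  (forall x y, f (x + y) = f x + f y) ->
  (forall c x, f (c%:MP *: x) = c%:MP *: f x) ->
  (forall j x, f ('X_j *: x) = 'X_j *: f x) -> linear f.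
Proof.
move=> fD fC fX s x y; rewrite fD; congr (_ + _).
move: s x {y}; elim/mpoly_generators_ind => [c x|p q IHp IHq x|j p IHp x] //.
  by rewrite !scalerDl fD IHp IHq.
by rewrite -!scalerA fX IHp.
Qed.

Lemma ghom_exists M N (f : M -> N) : linear f ->
  (forall a x, f (hcomp a x) = hcomp a (f x)) -> exists g : ghom M N, g =1 f.
Proof.
move=> fl fh; pose fL := GRing.isLinear.Build _ _ _ _ f fl.
pose g : {linear M -> N} := HB.pack f fL.
by exists (@GHom _ _ _ _ _ _ g fh).
Qed.

Lemma ghom_bij_giso M N (f : ghom M N) :
  injective f -> (forall y, exists x, f x = y) -> giso M N.
Proof.
move=> fI fS; exists f; exists (fun y => projT1 (cid (fS y))) => [x|y].
  by apply: fI; case: cid.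
by case: cid.
Qed.

(** Subtracting two related pairs, by linearity with coefficient -1, and applying the last
    hypothesis shows that [r] is single-valued and injective, hence the graph of an isomorphism. *)
Lemma giso_of_relation M N (r : M -> N -> Prop) :
  (forall s x y x' y', r x y -> r x' y' -> r (s *: x + x') (s *: y + y')) ->
  (forall a x y, r x y -> r (hcomp a x) (hcomp a y)) ->
  (forall x, exists y, r x y) -> (forall y, exists x, r x y) ->
  (forall x y, r x y -> x = 0 <-> y = 0) -> giso M N.
Proof.
move=> rl rh rM rN r0.
have rU x y x' y' : r x y -> r x' y' -> x = x' <-> y = y'.
  move=> xy xy'; have := r0 _ _ (rl (-1) _ _ _ _ xy xy').
  rewrite !scaleN1r => h; split=> [e|e].
    by apply/esym/eqP; rewrite -subr_eq0 addrC; apply/eqP/h; rewrite e addNr.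
  by apply/esym/eqP; rewrite -subr_eq0 addrC; apply/eqP/h; rewrite e addNr.
pose f x := projT1 (cid (rM x)); have rf x : r x (f x) by rewrite /f; case: cid.
have fE x y : r x y -> f x = y by move=> xy; apply/(rU _ _ _ _ (rf x) xy).
have [||g gE] := @ghom_exists M N f.
- by move=> s x y; apply: fE; apply: rl.
- by move=> a x; apply: fE; apply: rh.
apply: (@ghom_bij_giso _ _ g) => [x y|y]; last first.
  by have [x xy] := rN y; exists x; rewrite gE (fE _ _ xy).
by rewrite !gE => /(rU _ _ _ _ (rf x) (rf y)).
Qed.

Lemma giso_trans M N L : giso M N -> giso N L -> giso M L.
Proof.
case=> f fb [g gb]; have [||h hE] := @ghom_exists M L (g \o f).
- by move=> s x y; rewrite /= !linearP.
- by move=> a x; rewrite /= !ghom_hcomp.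
by exists h; apply: eq_bij (bij_comp gb fb) _ _ => x; rewrite hE.
Qed.

Section Image.
Variables (M N : gmod k w) (d : ghom M N).

Definition img_pred : {pred N} := fun y => `[< exists x, d x = y >].

Lemma img_closed : submod_closed img_pred.
Proof.
split=> [|s _ _ /asboolP[x <-] /asboolP[y <-]]; apply/asboolP.
  by exists 0; rewrite raddf0.
by exists (s *: x + y); rewrite linearP.
Qed.

Lemma img_hcomp a y : y \in img_pred -> hcomp a y \in img_pred.
Proof. by case/asboolP=> x <-; apply/asboolP; exists (hcomp a x); rewrite ghom_hcomp. Qed.

Definition gimg : hsubmod N := HSubmod img_closed img_hcomp.

End Image.

(** The map [f] descends to the image of [d], which embeds in [N], and extends from there. In this
    form injectivity applies to augmentations and differentials alike. *)
Lemma ginjective_factor M N I (d : ghom M N) (f : ghom M I) : ginjective I ->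
  (forall x, d x = 0 -> f x = 0) -> exists g : ghom N I, forall x, g (d x) = f x.
Proof.
move=> Iinj df.
have dfE x y : d x = d y -> f x = f y.
  move=> dxy; apply/eqP; rewrite -subr_eq0 -raddfB; apply/eqP/df.
  by rewrite raddfB /= dxy subrr.
have pre (y : gsub (gimg d)) : exists x, d x = val y by apply/asboolP/(valP y).
pose h y := f (projT1 (cid (pre y))).
have hE y x : d x = val y -> h y = f x.
  by move=> dx; apply: dfE; case: cid => z /= ->.
have [||hh hhE] := @ghom_exists (gsub (gimg d)) I h.
- move=> s y z; have [u du] := pre y; have [v dv] := pre z.
  by rewrite (hE _ _ du) (hE _ _ dv) -linearP; apply: hE; rewrite linearP du dv.
- move=> a y; have [u du] := pre y; rewrite (hE _ _ du) -ghom_hcomp; apply: hE.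
  by rewrite ghom_hcomp du.
have [||j jE] := @ghom_exists (gsub (gimg d)) N val => //.
have jI : injective j by move=> x y; rewrite !jE; apply: val_inj.
have [g gE] := Iinj _ _ j hh jI; exists g => x.
have xd : d x \in hsub_pred (gimg d) by apply/asboolP; exists x.
have := gE (exist (fun y => y \in hsub_pred (gimg d)) (d x) xd).
by rewrite jE hhE => ->; apply: hE.
Qed.

(** * Comparison of injective resolutions *)

Section Comparison.
Variables (M N : gmod k w) (R : ginjective_resolution M) (Q : ginjective_resolution N).

Lemma lift_to_resolution (f : ghom M N) :
  exists F : forall q, ghom (res_mod R q) (res_mod Q q),
  (forall x, F 0%N (res_aug R x) = res_aug Q (f x)) /\
  (forall q x, F q.+1 (res_diff R q x) = res_diff Q q (F q x)).
Proof.
(* The recursion must remember that g maps kernels of differentials to kernels: this is what lets d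
   g factor through the differential of [R] at the next stage. *)
pose St q := {g : ghom (res_mod R q) (res_mod Q q) |
  forall x, res_diff R q x = 0 -> res_diff Q q (g x) = 0}.
have [g0 g0E] : exists g : ghom (res_mod R 0) (res_mod Q 0),
    forall x, g (res_aug R x) = res_aug Q (f x).
  have [||af afE] := @ghom_exists M (res_mod Q 0) (res_aug Q \o f).
  - by move=> s x y; rewrite /= !linearP.
  - by move=> a x; rewrite /= !ghom_hcomp.
  have [x|g gE] := ginjective_factor (d := res_aug R) (f := af) (@res_inj _ _ _ _ _ Q 0).
    by rewrite -(raddf0 (res_aug R)) => /res_aug_inj ->; rewrite raddf0.
  by exists g => x; rewrite gE afE.
have P0 x : res_diff R 0 x = 0 -> res_diff Q 0 (g0 x) = 0.
  by move/res_exact0 => [y <-]; rewrite g0E; apply/res_exact0; exists (f y).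
have step q (s : St q) : {s' : St q.+1 |
    forall x, sval s' (res_diff R q x) = res_diff Q q (sval s x)}.
  apply: cid; case: s => g gP /=.
  have [||dg dgE] := @ghom_exists (res_mod R q) (res_mod Q q.+1) (res_diff Q q \o g).
  - by move=> s x y; rewrite /= !linearP.
  - by move=> a x; rewrite /= !ghom_hcomp.
  have [x|h hE] := ginjective_factor (d := res_diff R q) (f := dg)
    (@res_inj _ _ _ _ _ Q q.+1).
    by rewrite dgE; exact: gP.
  have hP x : res_diff R q.+1 x = 0 -> res_diff Q q.+1 (h x) = 0.
    by case/res_exactS => y <-; rewrite hE dgE; apply/res_exactS; exists (g y).
  by exists (exist _ h hP) => x; rewrite hE dgE.
pose s := fix s q : St q := if q is p.+1 then sval (step p (s p)) else exist _ g0 P0.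
exists (fun q => sval (s q)); split=> // q x.
by rewrite /=; case: (step q (s q)).
Qed.

Lemma resolution_homotopy (g : forall q, ghom (res_mod R q) (res_mod Q q)) :
  (forall x, g 0%N (res_aug R x) = 0) ->
  (forall q x, g q.+1 (res_diff R q x) = res_diff Q q (g q x)) ->
  exists s : forall q, ghom (res_mod R q.+1) (res_mod Q q),
  (forall x, g 0%N x = s 0%N (res_diff R 0 x)) /\
  (forall q x, g q.+1 x = res_diff Q q (s q x) + s q.+1 (res_diff R q.+1 x)).
Proof.
move=> ga gd.
have [x|s0 s0E] := ginjective_factor (d := res_diff R 0) (f := g 0%N)
  (@res_inj _ _ _ _ _ Q 0).
  by case/res_exact0 => y <-.
(* Kept with s: the difference g - d s vanishes on the image of the incoming differential. By
   exactness this image is the kernel of the outgoing one, through which the difference then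
   factors. *)
pose St q := {s : ghom (res_mod R q.+1) (res_mod Q q) |
  forall x, g q.+1 (res_diff R q x) = res_diff Q q (s (res_diff R q x))}.
have P0 x : g 1%N (res_diff R 0 x) = res_diff Q 0 (s0 (res_diff R 0 x)) by rewrite s0E.
have step q (s : St q) : {s' : St q.+1 |
    forall x, g q.+1 x = res_diff Q q (sval s x) + sval s' (res_diff R q.+1 x)}.
  apply: cid; case: s => s sP /=.
  have [||h hE] := @ghom_exists (res_mod R q.+1) (res_mod Q q.+1)
      (fun x => g q.+1 x - res_diff Q q (s x)).
  - by move=> c x y; rewrite 3!linearP /= scalerBr opprD addrACA.
  - by move=> a x; rewrite !ghom_hcomp raddfB.
  have [x|s' s'E] :=
      ginjective_factor (d := res_diff R q.+1) (f := h) (@res_inj _ _ _ _ _ Q q.+1).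
    by case/res_exactS => y <-; rewrite hE sP subrr.
  have gE x : g q.+1 x = res_diff Q q (s x) + s' (res_diff R q.+1 x).
    by rewrite s'E hE addrC subrK.
  have s'P x : g q.+2 (res_diff R q.+1 x) = res_diff Q q.+1 (s' (res_diff R q.+1 x)).
    rewrite gd gE raddfD /= (_ : res_diff Q _ (res_diff Q _ _) = 0) ?add0r //.
    by apply/res_exactS; exists (s x).
  by exists (exist _ s' s'P).
pose s := fix s q : St q := if q is p.+1 then sval (step p (s p)) else exist _ s0 P0.
exists (fun q => sval (s q)); split=> [x|q x]; first by rewrite s0E.
by rewrite /=; case: (step q (s q)).
Qed.

End Comparison.
End GradedModules.

(** * Cohomology classes and their representing cocycles *)

Section LocalCohomologyClasses.
Variables (k : fieldType) (n : nat) (A : zmodType) (w : 'I_n -> A).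
Variable E : 'X_{1..n} -> Prop.
Implicit Types M N : gmod k w.

Lemma torsion_ghom M N (f : ghom M N) x : torsion E x -> torsion E (f x).
Proof.
case=> t tx; exists t => fs sfs afs.
by rewrite -linearZ /= tx // raddf0.
Qed.

Section OneResolution.
Variables (M : gmod k w) (R : ginjective_resolution M) (q : nat).
Local Notation H := (local_cohomology E R q).

Let B := HSubmod (coboundary_closed E R q) (@coboundary_hcomp _ _ _ _ E M R q).

(** Hides the subtype of cocycles and the quotient by coboundaries, so that classes are handled
    through plain elements z of the resolution. *)
Definition class_of (x : H) (z : res_mod R q) : Prop :=
  exists2 c : cocycles E R q, val c = z & x = quo_pi B c.

Lemma class_of_ex x : exists z, class_of x z.
Proof. by have [c ->] := @quo_piK _ _ _ _ _ B x; exists (val c), c. Qed.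

Lemma ex_class_of z : torsion E z -> res_diff R q z = 0 -> exists x, class_of x z.
Proof.
move=> tz dz; have hz : z \in cocycle_pred E (R := R) (q := q) by apply/asboolP.
pose c : cocycles E R q := exist (fun z => z \in cocycle_pred E (q := q)) z hz.
by exists (quo_pi B c), c.
Qed.

Lemma class_of_cocycle x z : class_of x z -> torsion E z /\ res_diff R q z = 0.
Proof. by case=> c <- _; apply/asboolP/(valP c). Qed.

Lemma class_of_linear s x y z t :
  class_of x z -> class_of y t -> class_of (s *: x + y) (s *: z + t).
Proof.
move=> [c <- ->] [d <- ->]; exists (s *: c + d) => //.
by rewrite quo_piD quo_piZ.
Qed.

Lemma class_of_hcomp a x z : class_of x z -> class_of (hcomp a x) (hcomp a z).
Proof. by move=> [c <- ->]; exists (hcomp a c) => //; exact: (quo_hcompE B). Qed.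

Lemma class_of_eq0 x z : class_of x z -> x = 0 <-> is_coboundary E z.
Proof.
move=> [c <- ->]; rewrite -(quo_pi0 B); split=> [/quo_eqP|cz].
  by rewrite subr0 => /asboolP.
by apply/quo_eqP; rewrite subr0; apply/asboolP.
Qed.

Lemma class_of_eq x y z t : class_of x z -> class_of y t ->
  is_coboundary E (z - t) -> x = y.
Proof.
move=> xz yt zt; have := class_of_linear (-1) yt xz.
rewrite !scaleN1r addrC [- t + z]addrC => /class_of_eq0/iffRL/(_ zt).
by move/eqP; rewrite subr_eq0 => /eqP.
Qed.

End OneResolution.
End LocalCohomologyClasses.

(** * Independence of the resolution *)

Section Independence.
Variables (k : fieldType) (n : nat) (A : zmodType) (w : 'I_n -> A).
Variable E : 'X_{1..n} -> Prop.

(** A null homotopy s gives g z = d (s z) on cocycles, and s z is again torsion because s is linear.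
    In cohomological degree 0 it gives g z = 0, which is what [is_coboundary] asks there. *)
Lemma coboundary_of_null_lift (M N : gmod k w) (R : ginjective_resolution M)
    (Q : ginjective_resolution N) (g : forall q, ghom (res_mod R q) (res_mod Q q)) :
  (forall x, g 0%N (res_aug R x) = 0) ->
  (forall q x, g q.+1 (res_diff R q x) = res_diff Q q (g q x)) ->
  forall q x, torsion E x -> res_diff R q x = 0 -> is_coboundary E (g q x).
Proof.
move=> ga gd; have [s [s0 sS]] := resolution_homotopy ga gd.
case=> [|q] x tx dx /=; first by rewrite s0 dx raddf0.
by exists (s q x); [exact: torsion_ghom|rewrite sS dx raddf0 addr0].
Qed.

(** Over the zero module the identity of the resolution lifts the zero map, so every torsion cocycle
    is a coboundary. *)
Lemma local_cohomology_trivial (M : gmod k w) (R : ginjective_resolution M) q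
    (x : local_cohomology E R q) : (forall y : M, y = 0) -> x = 0.
Proof.
move=> M0; have [z xz] := class_of_ex x; apply/(class_of_eq0 xz).
have idE p : exists g : ghom (res_mod R p) (res_mod R p), g =1 id by apply: ghom_exists.
have [tz dz] := class_of_cocycle xz.
rewrite -(projT2 (cid (idE q)) z).
apply: (coboundary_of_null_lift (g := fun p => projT1 (cid (idE p)))) tz dz.
  by move=> y; rewrite (M0 y) !raddf0.
by move=> p y; rewrite !(projT2 (cid (idE _))).
Qed.

Lemma coboundary_ghom (M N : gmod k w) (R : ginjective_resolution M)
    (Q : ginjective_resolution N) (g : forall q, ghom (res_mod R q) (res_mod Q q)) :
  (forall q x, g q.+1 (res_diff R q x) = res_diff Q q (g q x)) ->
  forall q x, is_coboundary E x -> is_coboundary E (g q x).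
Proof.
move=> gd [|q] x /=; first by move=> ->; rewrite raddf0.
by case=> y ty <-; exists (g q y); [exact: torsion_ghom|rewrite gd].
Qed.

Lemma coboundary_add (M : gmod k w) (R : ginjective_resolution M) q (x y : res_mod R q) :
  is_coboundary E x -> is_coboundary E y -> is_coboundary E (x + y).
Proof.
case: q x y => [|q] x y /=; first by move=> -> ->; rewrite addr0.
move=> [x' tx <-] [y' ty <-]; exists (x' + y'); last by rewrite raddfD.
by rewrite -[x']scale1r; apply: torsionP.
Qed.

(** The chain map x - F' (F x) lifts id - f' f, which is zero. *)
Lemma lift_cancel (M N : gmod k w) (R : ginjective_resolution M)
    (Q : ginjective_resolution N) (f : ghom M N) (f' : ghom N M)
    (F : forall q, ghom (res_mod R q) (res_mod Q q))
    (F' : forall q, ghom (res_mod Q q) (res_mod R q)) : cancel f f' ->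
  (forall x, F 0%N (res_aug R x) = res_aug Q (f x)) ->
  (forall q x, F q.+1 (res_diff R q x) = res_diff Q q (F q x)) ->
  (forall x, F' 0%N (res_aug Q x) = res_aug R (f' x)) ->
  (forall q x, F' q.+1 (res_diff Q q x) = res_diff R q (F' q x)) ->
  forall q x, torsion E x -> res_diff R q x = 0 -> is_coboundary E (x - F' q (F q x)).
Proof.
move=> fK Fa Fd F'a F'd q x tx dx.
have gE p : exists g : ghom (res_mod R p) (res_mod R p), g =1 (fun x => x - F' p (F p x)).
  apply: ghom_exists => [s y z|a y]; last by rewrite raddfB /= !ghom_hcomp.
  by rewrite 2!linearP /= scalerBr opprD addrACA.
rewrite -(projT2 (cid (gE q)) x).
apply: (coboundary_of_null_lift (g := fun p => projT1 (cid (gE p)))) tx dx.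
  by move=> y; rewrite (projT2 (cid (gE _))) Fa F'a fK subrr.
by move=> p y; rewrite !(projT2 (cid (gE _))) Fd F'd raddfB.
Qed.

(** Covers both a change of resolution and a change of module within its isomorphism class. The
    class of z corresponds to that of F z; the lift F' of the inverse gives bijectivity, since both
    composites are the identity up to coboundaries. *)
Lemma local_cohomology_giso (M N : gmod k w) (R : ginjective_resolution M)
    (Q : ginjective_resolution N) q : giso M N ->
  giso (local_cohomology E R q) (local_cohomology E Q q).
Proof.
case=> f [h fK hK].
have [||f' f'E] := @ghom_exists _ _ _ _ N M h.
- by move=> s x y; apply: (can_inj fK); rewrite hK linearP !hK.
- by move=> a x; apply: (can_inj fK); rewrite hK ghom_hcomp hK.
have ff' : cancel f f' by move=> x; rewrite f'E fK.
have f'f : cancel f' f by move=> x; rewrite f'E hK.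
have [F [Fa Fd]] := lift_to_resolution R Q f.
have [F' [F'a F'd]] := lift_to_resolution Q R f'.
have FF' := lift_cancel ff' Fa Fd F'a F'd.
have F'F := lift_cancel f'f F'a F'd Fa Fd.
have Fcoc p z : torsion E z -> res_diff R p z = 0 ->
    torsion E (F p z) /\ res_diff Q p (F p z) = 0.
  by move=> tz dz; split; [exact: torsion_ghom|rewrite -Fd dz raddf0].
have F'coc p z : torsion E z -> res_diff Q p z = 0 ->
    torsion E (F' p z) /\ res_diff R p (F' p z) = 0.
  by move=> tz dz; split; [exact: torsion_ghom|rewrite -F'd dz raddf0].
apply: (@giso_of_relation _ _ _ _ _ _
  (fun x y => exists2 z, class_of x z & class_of y (F q z))).
- move=> s x y x' y' [z xz yz] [z' xz' yz'].
  by exists (s *: z + z'); rewrite ?linearP; apply: class_of_linear.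
- by move=> a x y [z xz yz]; exists (hcomp a z);
    rewrite ?ghom_hcomp; apply: class_of_hcomp.
- move=> x; have [z xz] := class_of_ex x; have [tz dz] := class_of_cocycle xz.
  have [tFz dFz] := Fcoc q z tz dz.
  by have [y yz] := ex_class_of tFz dFz; exists y, z.
- move=> y; have [z yz] := class_of_ex y; have [tz dz] := class_of_cocycle yz.
  have [tFz dFz] := F'coc q z tz dz; have [x xz] := ex_class_of tFz dFz.
  have [tFFz dFFz] := Fcoc q _ tFz dFz; have [y' y'z] := ex_class_of tFFz dFFz.
  by exists x, (F' q z) => //; rewrite (class_of_eq yz y'z (F'F _ _ tz dz)).
move=> x y [z xz yz]; have [tz dz] := class_of_cocycle xz.
split=> [/(class_of_eq0 xz) cz|/(class_of_eq0 yz) cz]; apply/class_of_eq0; eauto.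
  exact: coboundary_ghom.
rewrite -(subrK (F' q (F q z)) z); apply: coboundary_add; first exact: FF'.
exact: (coboundary_ghom F'd).
Qed.

End Independence.

(** * The part of fixed x_i-degree, as a graded S'-module *)

Section Slice.
Variables (k : fieldType) (n : nat) (i : 'I_n) (c : int) (M : gmod k (@fine_deg n)).
Local Notation A := {ffun 'I_n -> int}.
Local Notation A' := {ffun 'I_n.-1 -> int}.

Lemma restrict_scaleC (d : k) (x : restrict i M) : d%:MP *: x = d%:MP *: (x : M).
Proof. by rewrite -[LHS]/(sub_incl i _ *: (x : M)) /sub_incl mmapC. Qed.

Lemma restrict_scaleX j (x : restrict i M) : 'X_j *: x = 'X_(lift i j) *: (x : M).
Proof. by rewrite -[LHS]/(sub_incl i _ *: (x : M)) /sub_incl mmapX mmap1U. Qed.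

(** A projection onto x_i-degree c is not among the data of a graded module, so membership is the
    vanishing of all other components. The variables x_j with j != i leave the x_i-degree alone, so
    this is stable under S'. *)
Definition slice_pred : {pred restrict i M} :=
  fun x => `[< forall a : A, a i != c -> hcomp a x = 0 >].

Lemma slice_closed : submod_closed slice_pred.
Proof.
split=> [|s x y /asboolP hx /asboolP hy]; apply/asboolP => a nac.
  exact: raddf0.
rewrite hcompD hy // addr0.
elim/mpoly_generators_ind: s a nac => [d|p q IHp IHq|j p IHp] a nac.
- by rewrite hcompC hx // scaler0.
- by rewrite scalerDl hcompD IHp // IHq // addr0.
rewrite -scalerA hcompX_sub IHp ?scaler0 //.
by have := sub_deg_i i j (a - sub_deg i j); rewrite addrC subrK => <-.
Qed.

HB.instance Definition _ := GRing.isSubmodClosed.Build _ _ slice_pred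
  (GRing.submod_closed_semi slice_closed).

Definition slice_sort := {x : restrict i M | x \in slice_pred}.
HB.instance Definition _ := SubChoice.on slice_sort.
HB.instance Definition _ := [SubChoice_isSubLmodule of slice_sort by <:].

Lemma slice_hcomp_subproof (b : A') (x : slice_sort) :
  (hcomp (deg_join i c b) (val x) : restrict i M) \in slice_pred.
Proof.
apply/asboolP => a nac; rewrite hcomp_id; case: eqP => // e.
by rewrite e deg_joinE eqxx in nac.
Qed.

Definition slice_hcomp (b : A') (x : slice_sort) : slice_sort :=
  exist (fun x => x \in slice_pred) _ (slice_hcomp_subproof b x).

Lemma slice_hcompD b x y : slice_hcomp b (x + y) = slice_hcomp b x + slice_hcomp b y.
Proof. by apply: val_inj; exact: hcompD. Qed.

Lemma slice_hcomp_id a b x :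
  slice_hcomp a (slice_hcomp b x) = if a == b then slice_hcomp b x else 0.
Proof.
have := hcomp_id (deg_join i c a) (deg_join i c b) (val x).
rewrite (deg_eq i) !deg_joinE eqxx !deg_rest_join => e.
by apply: val_inj; rewrite [LHS]e; case: (a == b).
Qed.

Lemma slice_hcomp_sum x :
  exists2 s : seq A', uniq s & x = \sum_(a <- s) slice_hcomp a x.
Proof.
have [s us xE] := hcomp_sum (val x); have /asboolP hx := valP x.
exists (map (deg_rest i) [seq a : A <- s | a i == c]).
  rewrite map_inj_in_uniq ?filter_uniq // => a b.
  rewrite !mem_filter => /andP[/eqP ac _] /andP[/eqP bc _] e.
  by rewrite -(deg_join_rest i a) -(deg_join_rest i b) ac bc e.
apply: val_inj; rewrite [LHS]xE raddf_sum big_map big_filter /= [RHS]big_mkcond.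
apply: eq_bigr => a _; case: eqP => [<-|/eqP /hx //].
by rewrite deg_join_rest.
Qed.

Lemma slice_hcompC (d : k) a x : slice_hcomp a (d%:MP *: x) = d%:MP *: slice_hcomp a x.
Proof. by apply: val_inj; exact: (hcompC (g := restrict i M)). Qed.

Lemma deg_joinD (b d : A') : deg_join i c (b + d) = deg_join i 0 b + deg_join i c d.
Proof.
by apply/ffunP => l; rewrite !ffunE; case: unliftP => [j _|_]; rewrite ?ffunE ?add0r.
Qed.

Lemma deg_join_fine (j : 'I_n.-1) : deg_join i 0 (fine_deg j) = sub_deg i j.
Proof.
apply/ffunP => l; rewrite !ffunE; case: unliftP => [j' ->|->].
  by rewrite ffunE (inj_eq lift_inj).
by rewrite (negbTE (neq_lift _ _)).
Qed.

Lemma slice_hcompX j a x :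
  slice_hcomp (fine_deg j + a) ('X_j *: x) = 'X_j *: slice_hcomp a x.
Proof.
apply: val_inj; rewrite /= deg_joinD deg_join_fine.
exact: (hcompX (g := restrict i M)).
Qed.

(* M_(c; _), the x_i-degree c part of M. *)
Definition slice : gmod k (@fine_deg n.-1) :=
  GMod slice_hcompD slice_hcomp_id slice_hcomp_sum slice_hcompC slice_hcompX.

Lemma slice_hcomp_val b (x : slice) :
  val (hcomp b x : slice_sort) = hcomp (deg_join i c b) (val (x : slice_sort)).
Proof. by []. Qed.

Lemma slice_mem (x : slice) (a : A) :
  hcomp a (val (x : slice_sort) : M) =
  if a i == c then hcomp a (val (x : slice_sort)) else 0.
Proof.
by case: eqP => // /eqP nac; have /asboolP /(_ a nac) := valP (x : slice_sort). Qed.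

(** Projection onto the slice. The second clause, a finite sum of components of x, is what transfers
    torsion and the cocycle condition from x to its part. *)
Lemma slice_part_ex (x : M) : exists2 y : slice,
  forall a : A, hcomp a (val (y : slice_sort)) = if a i == c then hcomp a x else 0 &
  exists s : seq A, val (y : slice_sort) = \sum_(a <- s | a i == c) hcomp a x.
Proof.
have [s us xE] := hcomp_sum x; pose y : M := \sum_(a <- s | a i == c) hcomp a x.
have yE a : hcomp a y = if a i == c then hcomp a x else 0.
  rewrite [in RHS]xE /y !raddf_sum /= big_mkcond /=.
  case: eqP => [ac|nac]; last first.
    rewrite big1 // => b _; case: eqP => // bc; rewrite hcomp_id.
    by case: eqP => // ab; rewrite ab bc in nac.
  apply: eq_bigr => b _; case: eqP => // nbc; rewrite hcomp_id.
  by case: eqP => // ab; rewrite -ab ac in nbc.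
have ys : y \in slice_pred by apply/asboolP => a /negbTE nac; rewrite yE nac.
exists (exist (fun x => x \in slice_pred) y ys) => [a|]; first by rewrite yE.
by exists s.
Qed.

End Slice.

(** * The left adjoint of the slice *)

Section Induced.
Variables (k : fieldType) (n : nat) (i : 'I_n) (c : int) (N : gmod k (@fine_deg n.-1)).
Local Notation S' := {mpoly k[n.-1]}.
Local Notation A := {ffun 'I_n -> int}.
Implicit Types (p q : {poly S'}) (h : txk_sort N).

(** The formula is the Cauchy product of p with h read as a polynomial in x_i with coefficients in
    [N]. Its value at index 0 is p_0 h_0 = 0, as a family must have. *)
Lemma poly_act_subproof p h :
  (fun d : nat => \sum_(j < d.+1) p`_j *: val h (d - j)%N) \in @txk_pred k n N.
Proof.
have /asboolP[h0 [b hb]] := valP h; apply/asboolP; split.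
  by rewrite big_ord1 h0 scaler0.
(* Past this bound either j >= [size p], and the coefficient of p is zero, or d - j > b, and h is
   zero there. *)
exists (size p + b)%N => d pbd; rewrite big1 // => j _.
have [pj|jp] := leqP (size p) j; first by rewrite nth_default ?scale0r.
rewrite hb ?scaler0 // ltn_subRL; apply: leq_ltn_trans pbd.
by rewrite leq_add2r ltnW.
Qed.

Definition poly_act p h : txk_sort N :=
  exist (fun g => g \in @txk_pred k n N) _ (poly_act_subproof p h).

Lemma poly_actE p h d : val (poly_act p h) d = \sum_(j < d.+1) p`_j *: val h (d - j)%N.
Proof. by []. Qed.

Lemma poly_actDl p q h : poly_act (p + q) h = poly_act p h + poly_act q h.
Proof.
apply: txk_eq => d; rewrite txk_valD !poly_actE -big_split.
by apply: eq_bigr => j _; rewrite coefD scalerDl.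
Qed.

Lemma poly_actDr p h h' : poly_act p (h + h') = poly_act p h + poly_act p h'.
Proof.
apply: txk_eq => d; rewrite txk_valD !poly_actE -big_split.
by apply: eq_bigr => j _; rewrite txk_valD scalerDr.
Qed.

Lemma poly_actC s h : poly_act s%:P h = s *: h.
Proof.
apply: txk_eq => d; rewrite txk_valZ poly_actE big_ord_recl coefC subn0 big1 ?addr0 //.
by move=> j _; rewrite coefC scale0r.
Qed.

Lemma poly_actCM s p h : poly_act (s%:P * p) h = s *: poly_act p h.
Proof.
apply: txk_eq => d; rewrite txk_valZ !poly_actE scaler_sumr.
by apply: eq_bigr => j _; rewrite coefCM scalerA.
Qed.

Lemma poly_actMX p h d :
  val (poly_act (p * 'X) h) d = if d is e.+1 then val (poly_act p h) e else 0.
Proof.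
rewrite poly_actE big_ord_recl coefMX scale0r add0r.
case: d => [|d]; first by rewrite big_ord0.
by rewrite poly_actE; apply: eq_bigr => j _; rewrite coefMX.
Qed.

Lemma poly_actX h d : val (poly_act 'X h) d = if d is e.+1 then val h e else 0.
Proof. by rewrite -['X]mul1r poly_actMX; case: d => // d; rewrite poly_actC scale1r. Qed.

Lemma poly_actA p q h : poly_act p (poly_act q h) = poly_act (p * q) h.
Proof.
elim/poly_ind: p => [|p s IHp]; first by rewrite mul0r -polyC0 !poly_actC !scale0r.
rewrite mulrDl !poly_actDl poly_actC poly_actCM; congr (_ + _).
apply: txk_eq => d; rewrite mulrAC !poly_actMX; case: d => // d.
by rewrite IHp.
Qed.

(** A second name for the carrier of [tensor_xk], which already has an S'-structure and here
    receives one over S. Sharing the carrier makes [tensor_xk_universal] available for maps out of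
    the induced module. *)
Definition ind_sort : Type := txk_sort N.
HB.instance Definition _ := GRing.Zmodule.on ind_sort.

(* k[x_1, ..., x_n] = k[x_j : j != i][x_i] *)
Definition to_poly : {mpoly k[n]} -> {poly S'} :=
  mmap (polyC \o @mpolyC n.-1 k)
    (fun l => if unlift i l is Some j then ('X_j : S')%:P else 'X).

HB.instance Definition _ := GRing.RMorphism.on to_poly.

Definition ind_scale (s : {mpoly k[n]}) (h : ind_sort) : ind_sort :=
  poly_act (to_poly s) h.

Lemma ind_scaleA s t h : ind_scale s (ind_scale t h) = ind_scale (s * t) h.
Proof.
rewrite /ind_scale (_ : to_poly (s * t) = to_poly s * to_poly t) ?poly_actA //.
exact: rmorphM.
Qed.

Lemma ind_scale1 : left_id 1 ind_scale.
Proof. by move=> h; rewrite /ind_scale rmorph1 poly_actC scale1r. Qed.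

Lemma ind_scaleDr : right_distributive ind_scale +%R.
Proof. by move=> s x y; exact: poly_actDr. Qed.

Lemma ind_scaleDl x : {morph ind_scale^~ x : s t / s + t}.
Proof.
move=> s t; rewrite /ind_scale.
have -> : to_poly (s + t) = to_poly s + to_poly t by exact: rmorphD.
exact: (poly_actDl (to_poly s) (to_poly t) x).
Qed.

HB.instance Definition _ := GRing.Zmodule_isLmodule.Build {mpoly k[n]} ind_sort
  ind_scaleA ind_scale1 ind_scaleDr ind_scaleDl.

Lemma ind_scaleC (d : k) (h : ind_sort) : d%:MP *: h = d%:MP *: (h : txk_sort N).
Proof. by rewrite -[LHS]/(poly_act (to_poly _) h) /to_poly mmapC poly_actC. Qed.

Lemma ind_scaleXlift j (h : ind_sort) :
  'X_(lift i j) *: h = 'X_j *: (h : txk_sort N).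
Proof.
by rewrite -[LHS]/(poly_act (to_poly _) h) /to_poly mmapX mmap1U liftK poly_actC.
Qed.

Lemma ind_scaleX (h : ind_sort) d :
  val ('X_i *: h : txk_sort N) d = if d is e.+1 then val (h : txk_sort N) e else 0.
Proof.
rewrite -poly_actX; congr (val _ d).
by rewrite -[LHS]/(poly_act (to_poly _) h) /to_poly mmapX mmap1U unlift_none.
Qed.

(* The members of a family are indexed from 1 (index 0 is junk); index d is to
   have x_i-degree c - 1 + d. *)
Definition ind_shift : A := deg_join i (c - 1) 0.

Lemma ind_shift_rest (a : A) : deg_rest i (a - ind_shift) = deg_rest i a.
Proof. by apply/ffunP => j; rewrite !ffunE liftK ffunE subr0. Qed.

Lemma ind_shiftE (a : A) : (a - ind_shift) i = a i - (c - 1).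
Proof. by rewrite !ffunE unlift_none. Qed.

Definition ind_hcomp (a : A) (h : ind_sort) : ind_sort := txk_hcomp i (a - ind_shift) h.

Lemma ind_hcompD a x y : ind_hcomp a (x + y) = ind_hcomp a x + ind_hcomp a y.
Proof. exact: txk_hcompD. Qed.

Lemma ind_hcomp_id a b x :
  ind_hcomp a (ind_hcomp b x) = if a == b then ind_hcomp b x else 0.
Proof. by rewrite /ind_hcomp txk_hcomp_id (inj_eq (addIr _)). Qed.

Lemma ind_hcomp_sum x : exists2 s : seq A, uniq s & x = \sum_(a <- s) ind_hcomp a x.
Proof.
have [s us xE] := txk_hcomp_sum i x; exists (map (fun a => a + ind_shift) s).
  by rewrite map_inj_uniq //; exact: addIr.
by rewrite big_map [LHS]xE; apply: eq_bigr => a _; rewrite /ind_hcomp addrK.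
Qed.

Lemma ind_hcompC (d : k) a x : ind_hcomp a (d%:MP *: x) = d%:MP *: ind_hcomp a x.
Proof. by rewrite !ind_scaleC; exact: txk_hcompC. Qed.

Lemma ind_hcompX j a x : ind_hcomp (fine_deg j + a) ('X_j *: x) = 'X_j *: ind_hcomp a x.
Proof.
have [j' ->|->] := unliftP i j.
  by rewrite !ind_scaleXlift /ind_hcomp -addrA; exact: txk_hcompX.
apply: txk_eq => d; rewrite ind_scaleX !txk_hcompE ind_scaleX -addrA.
rewrite !ffunE eqxx unlift_none.
case: d => [|d].
  by case: ifP => _ //; exact: raddf0.
(* Multiplication by x_i raises both the x_i-degree and the index by one; the two ones cancel. *)
rewrite -(natz d.+1) -addn1 natrD addrC natz (inj_eq (addIr _)).
have -> : deg_rest i (fine_deg i + (a - ind_shift)) = deg_rest i (a - ind_shift).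
  by apply/ffunP => l; rewrite !ffunE eq_sym (negbTE (neq_lift _ _)) add0r.
by rewrite natz txk_hcompE ind_shiftE.
Qed.

(* N \otimes_k x_i^c k[x_i]. *)
Definition induced : gmod k (@fine_deg n) :=
  GMod ind_hcompD ind_hcomp_id ind_hcomp_sum ind_hcompC ind_hcompX.

End Induced.

(** * The adjunction, and injectivity of slices *)

Section Adjunction.
Variables (k : fieldType) (n : nat) (i : 'I_n) (c : int).
Local Notation A := {ffun 'I_n -> int}.

Lemma hcompXn_sub (A : zmodType) (w : 'I_n -> A) (M : gmod k w) j e a (x : M) :
  hcomp a ('X_j ^+ e *: x) = 'X_j ^+ e *: hcomp (a - w j *+ e) x.
Proof.
elim: e a => [|e IHe] a; first by rewrite !expr0 !scale1r subr0.
by rewrite exprS -!scalerA hcompX_sub IHe mulrS opprD addrA.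
Qed.

Lemma ind_map (M N : gmod k (@fine_deg n.-1)) (f : ghom M N) :
  exists F : ghom (induced i c M) (induced i c N),
    forall h d, val (F h : txk_sort N) d = f (val (h : txk_sort M) d).
Proof.
have fin (h : txk_sort M) : (fun d => f (val h d)) \in @txk_pred k n N.
  have /asboolP[h0 [b hb]] := valP h; apply/asboolP.
  by split; [rewrite h0 raddf0|exists b => d /hb ->; rewrite raddf0].
pose F (h : induced i c M) : induced i c N :=
  exist (fun g => g \in @txk_pred k n N) _ (fin h).
have [||G GE] := @ghom_exists _ _ _ _ (induced i c M) (induced i c N) F.
- apply: linear_of_generators => [x y|d x|j x].
  + by apply: txk_eq => d; rewrite /= raddfD.
  + rewrite !ind_scaleC; apply: txk_eq => e.
    by rewrite -[LHS]/(f (_ *: _)) linearZ.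
  have [j' ->|->] := unliftP i j.
    rewrite !ind_scaleXlift; apply: txk_eq => e.
    by rewrite -[LHS]/(f (_ *: _)) linearZ.
  apply: txk_eq => d; rewrite -[LHS]/(f (val ('X_i *: x : txk_sort M) d)).
  by rewrite !ind_scaleX; case: d => // ; exact: raddf0.
- move=> a x; apply: txk_eq => d; rewrite -[LHS]/(f (val (txk_hcomp _ _ _) d)).
  rewrite txk_hcompE -[RHS]/(val (txk_hcomp _ _ (F x)) d) txk_hcompE.
  by case: ifP => _; [exact: ghom_hcomp|exact: raddf0].
by exists G => h d; rewrite GE.
Qed.

(** The unit of the adjunction: index 1 is the place of x_i-degree c, whence the factor 'X. *)
Definition ind_unit (N : gmod k (@fine_deg n.-1)) (x : N) : induced i c N :=
  (pure_xk i x 'X : txk_sort N).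

Lemma ind_unitE (N : gmod k (@fine_deg n.-1)) (x : N) d :
  val (ind_unit x : txk_sort N) d = if d == 1%N then x else 0.
Proof.
rewrite /ind_unit pure_xkE coefX; case: d => [|[|d]] //=.
  by rewrite mpolyC1 scale1r.
by rewrite mpolyC0 scale0r.
Qed.

Lemma ind_hcomp_pure (N : gmod k (@fine_deg n.-1)) (x : N) e (a : A) :
  hcomp a (pure_xk i x 'X^(e.+1) : induced i c N) =
  if a i - e%:Z == c then
    (pure_xk i (hcomp (deg_rest i a) x) 'X^(e.+1) : txk_sort N) else 0.
Proof.
apply: txk_eq => d; rewrite -[LHS]/(val (txk_hcomp _ _ _) d) txk_hcompE.
rewrite ind_shiftE ind_shift_rest !pure_xkE coefXn.
have [->|nde] := eqVneq d e.+1.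
  rewrite mpolyC1 scale1r (_ : (_ == _) = (a i - e%:Z == c)).
    by case: ifP => // _; rewrite pure_xkE coefXn eqxx mpolyC1 scale1r.
  rewrite opprB -subr_eq0 -[RHS]subr_eq0; congr (_ == _).
  by rewrite -addn1 PoszD; ring.
rewrite mpolyC0 scale0r !if_same raddf0 !if_same; case: ifP => // _.
by rewrite pure_xkE coefXn (negbTE nde) mpolyC0 scale0r if_same.
Qed.

Lemma ind_transpose (N : gmod k (@fine_deg n.-1)) (I : gmod k (@fine_deg n))
    (g : ghom (induced i c N) I) :
  exists f : ghom N (slice i c I),
    forall x, val (f x : slice_sort i c I) = g (ind_unit x).
Proof.
have sl (x : N) : (g (ind_unit x) : restrict i I) \in @slice_pred k n i c I.
  apply/asboolP => a nac; rewrite -[LHS]/(hcomp a (g _)) -ghom_hcomp.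
  by rewrite /ind_unit -['X]expr1 ind_hcomp_pure subr0 (negbTE nac) raddf0.
pose f (x : N) : slice i c I := exist (fun y => y \in @slice_pred k n i c I) _ (sl x).
have [||F FE] := @ghom_exists _ _ _ _ N (slice i c I) f.
- apply: linear_of_generators => [x y|d x|j x]; apply: val_inj.
  + rewrite -[LHS]/(g _) -[RHS]/(g _ + g _) -raddfD; congr (g _).
    by apply: txk_eq => d; rewrite txk_valD !ind_unitE; case: ifP => _; rewrite ?addr0.
  + rewrite -[LHS]/(g _) -[RHS]/(_ *: (g _ : restrict i I)) restrict_scaleC -linearZ /=.
    congr (g _); rewrite ind_scaleC; apply: txk_eq => e.
    by rewrite txk_valZ !ind_unitE; case: ifP => _; rewrite ?scaler0.
  rewrite -[LHS]/(g _) -[RHS]/(_ *: (g _ : restrict i I)) restrict_scaleX -linearZ /=.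
  congr (g _); rewrite ind_scaleXlift; apply: txk_eq => e.
  by rewrite txk_valZ !ind_unitE; case: ifP => _; rewrite ?scaler0.
- move=> b x; apply: val_inj; rewrite slice_hcomp_val -[LHS]/(g _).
  rewrite -[RHS]/(hcomp _ (g _)) -ghom_hcomp; congr (g _).
  by rewrite /ind_unit -['X]expr1 ind_hcomp_pure subr0 deg_joinE eqxx deg_rest_join.
by exists F => x; rewrite FE.
Qed.

(** The other transpose: the tensor of x with 'X^(e+1), which stands for x_i-degree c + e, goes to
    x_i^e f(x). *)
Lemma ind_counit (N : gmod k (@fine_deg n.-1)) (I : gmod k (@fine_deg n))
    (f : ghom N (slice i c I)) :
  exists g : ghom (induced i c N) I,
    forall x, g (ind_unit x) = val (f x : slice_sort i c I).
Proof.
pose v x : I := val (f x : slice_sort i c I).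
(* [drop_poly 1] divides by the variable, because the generators of the induced module are stored at
   index 1. *)
pose ev (p : {poly k}) := (map_poly (@mpolyC n k) (drop_poly 1 p)).['X_i].
have evXn e : ev 'X^(e.+1) = 'X_i ^+ e.
  rewrite /ev (_ : drop_poly 1 _ = 'X^e) ?map_polyXn ?hornerXn //.
  by apply/polyP => d; rewrite coef_drop_poly !coefXn addn1.
pose b x p : restrict i I := ev p *: v x.
have vl s x y : (v (s *: x + y) : restrict i I) = s *: (v x : restrict i I) + v y.
  by rewrite /v linearP.
have bb : xk_bilinear b.
  split=> [s x y p _|d x p r _ _]; rewrite /b.
    rewrite vl -[RHS]/(sub_incl i s *: (ev p *: v x) + ev p *: v y).
    by rewrite scalerA mulrC -scalerA -scalerDr.
  rewrite /ev linearP rmorphD /= map_polyZ hornerD hornerZ scalerDl -scalerA.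
  by rewrite restrict_scaleC.
have [g gE _] := tensor_xk_universal i bb.
have gX x e : g (pure_xk i x 'X^(e.+1)) = 'X_i ^+ e *: v x.
  by rewrite gE ?xk_coefXn0 // /b evXn.
(* Additive maps that agree on these pure tensors are equal. Taking components is additive but not
   S'-linear, so the uniqueness clause of [tensor_xk_universal] would not cover it. *)
have pure_span (U : zmodType) (u u' : induced i c N -> U) :
    (forall x y, u (x + y) = u x + u y) -> (forall x y, u' (x + y) = u' x + u' y) ->
    (forall x e, u (pure_xk i x 'X^(e.+1)) = u' (pure_xk i x 'X^(e.+1))) -> u =1 u'.
  move=> uD u'D uu' h; have /asboolP[_ [B hB]] := valP (h : txk_sort N).
  have u0 (t : induced i c N -> U) : (forall x y, t (x + y) = t x + t y) -> t 0 = 0.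
    by move=> tD; apply: (addrI (t 0)); rewrite -tD !addr0.
  rewrite (txk_decomp i hB) (big_morph u uD (u0 u uD)) (big_morph u' u'D (u0 u' u'D)).
  by apply: eq_bigr => e _; exact: uu'.
have gD (x y : induced i c N) : g (x + y) = g x + g y by exact: raddfD.
have [||G GE] := @ghom_exists _ _ _ _ (induced i c N) I g.
- apply: linear_of_generators => [//|d x|j x].
    by rewrite ind_scaleC -restrict_scaleC linearZ.
  have [j' ->|->] := unliftP i j.
    by rewrite ind_scaleXlift -restrict_scaleX linearZ.
  move: x; apply: (pure_span I (fun h => g ('X_i *: h : induced i c N))
      (fun h => 'X_i *: (g h : I))) => [x y|x y|x e].
  + by rewrite scalerDr gD.
  + by rewrite gD; exact: (@scalerDr _ I).
  have eX : 'X_i *: (pure_xk i x 'X^(e.+1) : induced i c N) = pure_xk i x 'X^(e.+2).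
    apply: txk_eq => d; rewrite ind_scaleX pure_xkE coefXn.
    case: d => [|[|d]] //; first by rewrite mpolyC0 scale0r.
    by rewrite pure_xkE coefXn eqSS.
  by apply: etrans (congr1 g eX) _; rewrite !gX scalerA -exprS.
- move=> a; apply: (pure_span I (fun h => g (hcomp a h)) (fun h => hcomp a (g h : I)))
      => [x y|x y|x e].
  + by rewrite hcompD gD.
  + by rewrite gD; exact: (hcompD (g := I)).
  rewrite ind_hcomp_pure gX hcompXn_sub /v slice_mem.
  have -> : (a - fine_deg i *+ e) i = a i - e%:Z.
    by rewrite !ffunE ffunMnE ffunE eqxx -[true%:R]/(1 : int) natz.
  case: eqP => [ac|_]; last by rewrite scaler0; exact: raddf0.
  rewrite gX /v ghom_hcomp slice_hcomp_val; congr (_ *: hcomp _ _).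
  rewrite -(deg_join_rest i (a - _)) !ffunE ffunMnE ffunE eqxx.
  rewrite -[true%:R]/(1 : int) natz ac.
  congr deg_join; apply/ffunP => j; rewrite !ffunE ffunMnE ffunE.
  by rewrite eq_sym (negbTE (neq_lift _ _)) mul0rn subr0.
exists G => x; rewrite GE.
by have := gX x 0%N; rewrite expr1 expr0 scale1r.
Qed.

Lemma slice_ginjective (I : gmod k (@fine_deg n)) :
  ginjective I -> ginjective (slice i c I).
Proof.
move=> Iinj M N j f jI.
have [J JE] := ind_map j; have [f' f'E] := ind_counit f.
have JI : injective J.
  move=> x y xy; apply: txk_eq => d; apply: jI.
  by rewrite -!JE xy.
have [g' g'E] := Iinj _ _ J f' JI; have [g gE] := ind_transpose g'.
exists g => x; apply: val_inj; rewrite gE -f'E -g'E; congr (g' _).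
by apply: txk_eq => d; rewrite JE !ind_unitE; case: ifP => // _; rewrite raddf0.
Qed.

End Adjunction.

(** * The slice of an injective resolution *)

Section SliceResolution.
Variables (k : fieldType) (n : nat) (i : 'I_n) (c : int).
Local Notation A := {ffun 'I_n -> int}.

Lemma slice_hom_ex (M N : gmod k (@fine_deg n)) (f : ghom M N) :
  exists F : ghom (slice i c M) (slice i c N),
    forall x, val (F x : slice_sort i c N) = f (val (x : slice_sort i c M)).
Proof.
have sl (x : slice i c M) : f (val (x : slice_sort i c M)) \in @slice_pred k n i c N.
  apply/asboolP => a nac; rewrite -[LHS]/(hcomp a (f _)) -ghom_hcomp slice_mem.
  by rewrite (negbTE nac) raddf0.
pose F x : slice i c N := exist (fun y => y \in @slice_pred k n i c N) _ (sl x).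
have [||G GE] := @ghom_exists _ _ _ _ (slice i c M) (slice i c N) F.
- move=> s x y; apply: val_inj; rewrite -[LHS]/(f (sub_incl i s *: _ + _)).
  exact: linearP.
- by move=> b x; apply: val_inj; exact: (ghom_hcomp f (deg_join i c b)).
by exists G => x; rewrite GE.
Qed.

Definition slice_hom M N f := projT1 (cid (@slice_hom_ex M N f)).

Lemma slice_homE M N f x :
  val (@slice_hom M N f x : slice_sort i c N) = f (val (x : slice_sort i c M)).
Proof. by rewrite /slice_hom; case: cid. Qed.

Lemma slice_val_ext (M : gmod k (@fine_deg n)) (x : slice i c M) (y : M) :
  (forall a : A, a i = c -> hcomp a y = hcomp a (val (x : slice_sort i c M))) ->
  (forall a : A, a i != c -> hcomp a y = 0) -> y = val (x : slice_sort i c M).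
Proof.
move=> xy y0; apply: hcomp_ext => a; rewrite slice_mem.
by case: eqP => [/xy //|/eqP/y0].
Qed.

(** Since f commutes with components, cutting y down to x_i-degree c does not change its image. The
    formula for y' carries torsion over from y. *)
Lemma slice_preimage (M N : gmod k (@fine_deg n)) (f : ghom M N) (x : slice i c N) y :
  f y = val (x : slice_sort i c N) -> exists2 y' : slice i c M,
    slice_hom f y' = x & exists s : seq A, val (y' : slice_sort i c M) =
      \sum_(a <- s | a i == c) hcomp a y.
Proof.
move=> fy; have [y' y'E y's] := slice_part_ex i c y; exists y' => //.
apply: val_inj; rewrite slice_homE; apply: slice_val_ext => a ac.
  by rewrite -ghom_hcomp y'E ac eqxx ghom_hcomp fy.
by rewrite -ghom_hcomp y'E (negbTE ac) raddf0.
Qed.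

Lemma slice_exact (M N L : gmod k (@fine_deg n)) (f : ghom M N) (g : ghom N L) :
  (forall x, g x = 0 <-> exists y, f y = x) ->
  forall x, slice_hom g x = 0 <-> exists y, slice_hom f y = x.
Proof.
move=> fg x; split=> [gx|[y <-]].
  have /fg[y /slice_preimage[y' <- _]] : g (val (x : slice_sort i c N)) = 0.
    by rewrite -slice_homE gx.
  by exists y'.
by apply: val_inj; rewrite !slice_homE; apply/fg; eexists.
Qed.

Lemma slice_hom_inj (M N : gmod k (@fine_deg n)) (f : ghom M N) :
  injective f -> injective (slice_hom f).
Proof.
move=> fI x y xy; apply/val_inj/fI.
by have := congr1 (fun u : slice_sort i c N => val u) xy; rewrite !slice_homE.
Qed.

Definition slice_resolution (M : gmod k (@fine_deg n)) (R : ginjective_resolution M) :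
    ginjective_resolution (slice i c M) :=
  @GInjRes _ _ _ _ (slice i c M) (fun q => slice i c (res_mod R q))
    (slice_hom (res_aug R)) (fun q => slice_hom (res_diff R q))
    (fun q => slice_ginjective (@res_inj _ _ _ _ _ R q))
    (slice_hom_inj (@res_aug_inj _ _ _ _ _ R))
    (slice_exact (@res_exact0 _ _ _ _ _ R))
    (fun q => slice_exact (@res_exactS _ _ _ _ _ R q)).

End SliceResolution.

(** Torsion tests all products of elements of the ideal; products of its generating variables
    suffice. With a free index type for these variables, the condition for p_i over S and the one
    for m' over S' become the same. *)
Lemma torsion_variables (k : fieldType) n (A : zmodType) (w : 'I_n -> A) (M : gmod k w)
    (J : Type) (v : J -> 'I_n) (E : 'X_{1..n} -> Prop) (x : M) :
  (forall e, E e <-> exists j, e = U_(v j)%MM) ->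
  torsion E x <-> exists t, forall js : seq J, size js = t ->
    (\prod_(j <- js) 'X_(v j) : {mpoly k[n]}) *: x = 0.
Proof.
move=> Ev; split=> [[t tx]|[t tx]]; exists t.
  move=> js js_t; rewrite -(big_map (fun j => 'X_(v j)) xpredT id); apply: tx.
    by rewrite size_map.
  move=> f; elim: js {js_t} => //= j js IHjs; rewrite inE => /predU1P[->|/IHjs//].
  exists [:: (1, U_(v j)%MM)]; last by rewrite big_seq1 mul1r.
  by move=> u; rewrite inE => /eqP ->; apply/Ev; exists j.
apply: torsion_monom => es es_t esE.
have [js js_es] : exists js, es = map (fun j => U_(v j)%MM) js.
  elim: es esE {es_t} => [|e es IHes] esE; first by exists [::].
  have [|js ->] := IHes; first by move=> f fes; apply: esE; rewrite inE fes orbT.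
  have /Ev[j ->] := esE e (mem_head _ _).
  by exists (j :: js).
rewrite js_es size_map in es_t *.
rewrite (big_morph (fun e => 'X_[e] : {mpoly k[n]}) (@mpolyXD _ _) (@mpolyX0 _ _)).
by rewrite big_map tx // -es_t js_es size_map.
Qed.

(** * Local cohomology commutes with slices *)

Section SliceCohomology.
Variables (k : fieldType) (n : nat) (i : 'I_n) (c : int).
Local Notation A := {ffun 'I_n -> int}.

Lemma vertex_primeE e : vertex_prime i e <-> exists j, e = U_(lift i j)%MM.
Proof.
split=> [[j ji ->]|[j ->]]; last by exists (lift i j); rewrite // eq_sym neq_lift.
by case: (unliftP i j) ji => [j' ->|->]; [exists j'|rewrite eqxx].
Qed.

Lemma restrict_scale_prod (M : gmod k (@fine_deg n)) (x : restrict i M) js :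
  (\prod_(j <- js) 'X_j : {mpoly k[n.-1]}) *: x =
  (\prod_(j <- js) 'X_(lift i j) : {mpoly k[n]}) *: (x : M).
Proof.
elim: js => [|j js IHjs]; first by rewrite !big_nil !scale1r.
by rewrite !big_cons -!scalerA IHjs restrict_scaleX.
Qed.

Lemma torsion_slice (M : gmod k (@fine_deg n)) (x : slice i c M) :
  torsion (@max_ideal n.-1) x <->
  torsion (vertex_prime i) (val (x : slice_sort i c M) : M).
Proof.
rewrite (@torsion_variables _ _ _ _ _ _ id (@max_ideal n.-1)) //.
rewrite (torsion_variables _ vertex_primeE).
by split=> -[t tx]; exists t => js /tx; rewrite -restrict_scale_prod;
  [move/(congr1 (fun u : slice_sort i c M => val u))|move=> h; apply: val_inj].
Qed.

Lemma torsion_sum (M : gmod k (@fine_deg n)) E (s : seq A) (P : pred A) (x : M) :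
  torsion E x -> torsion E (\sum_(a <- s | P a) hcomp a x).
Proof.
move=> tx; apply: big_ind => [|u v tu tv|a _]; first exact: torsion0.
  by rewrite -[u]scale1r; apply: torsionP.
exact: torsion_hcomp.
Qed.

Lemma coboundary0 E (M : gmod k (@fine_deg n)) (R : ginjective_resolution M) q :
  is_coboundary E (0 : res_mod R q).
Proof. by case: q => [//|q]; exists 0; [exact: torsion0|exact: raddf0]. Qed.

Lemma slice_coboundary (M : gmod k (@fine_deg n)) (R : ginjective_resolution M) q
    (z : res_mod (slice_resolution i c R) q) :
  is_coboundary (vertex_prime i)
    (val (z : slice_sort i c (res_mod R q)) : res_mod R q) <->
  is_coboundary (@max_ideal n.-1) z.
Proof.
case: q z => [|q] z /=; first by split=> [z0|-> //]; exact: val_inj.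
split=> [[y ty /slice_preimage[y' y'z [s y'E]]]|[y ty <-]].
  by exists y' => //; apply/torsion_slice; rewrite y'E; apply: torsion_sum.
by exists (val (y : slice_sort i c _)); [apply/torsion_slice|rewrite -slice_homE].
Qed.

Lemma slice_local_cohomology (M : gmod k (@fine_deg n)) (R : ginjective_resolution M) q :
  giso (slice i c (local_cohomology (vertex_prime i) R q))
       (local_cohomology (@max_ideal n.-1) (slice_resolution i c R) q).
Proof.
set H := local_cohomology (vertex_prime i) R q.
pose sv (M' : gmod k (@fine_deg n)) (x : slice i c M') : M' :=
  val (x : slice_sort i c M').
have class0 (x : H) : class_of x 0 -> x = 0.
  by move/class_of_eq0/iffRL; apply; exact: coboundary0.
have d0 (z : slice i c (res_mod R q)) :
    res_diff (slice_resolution i c R) q z = 0 <-> res_diff R q (sv _ z) = 0.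
  rewrite -slice_homE; split=> [->//|dz]; exact: val_inj.
apply: (@giso_of_relation _ _ _ _ _ _ (fun x y =>
  exists2 z : slice i c (res_mod R q), class_of (sv H x) (sv _ z) &
     class_of (R := slice_resolution i c R) y z)).
- move=> s x y x' y' [z xz yz] [z' xz' yz']; exists (s *: z + z').
    exact: (class_of_linear (sub_incl i s) xz xz').
  exact: class_of_linear.
- move=> b x y [z xz yz]; exists (hcomp b z); last exact: class_of_hcomp.
  exact: (class_of_hcomp (deg_join i c b) xz).
- move=> x; have [z0 xz0] := class_of_ex (sv H x).
  have [tz0 dz0] := class_of_cocycle xz0.
  (* The cocycle [z0] may have components outside x_i-degree c. Its part z is still a torsion
     cocycle, and its class is x again because x has no such components. *)
  have [z zE [s zs]] := slice_part_ex i c z0.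
  have tz : torsion (vertex_prime i) (sv _ z) by rewrite /sv zs; exact: torsion_sum.
  have dz : res_diff R q (sv _ z) = 0.
    by rewrite /sv zs raddf_sum big1 // => a _; rewrite /= ghom_hcomp dz0 raddf0.
  have [x' x'z] := ex_class_of tz dz.
  have x'E : x' = sv H x.
    apply: slice_val_ext => a ac; have := class_of_hcomp a x'z; rewrite /sv zE.
      rewrite ac eqxx => h; apply: (class_of_eq h (class_of_hcomp a xz0)).
      by rewrite subrr; exact: coboundary0.
    by rewrite (negbTE ac) => /class0.
  have [y yz] := ex_class_of (R := slice_resolution i c R)
    (iffRL (torsion_slice z) tz) (iffRL (d0 z) dz).
  by exists y, z => //; rewrite -x'E.
- move=> y; have [z yz] := class_of_ex y; have [tz dz] := class_of_cocycle yz.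
  have [x xz] := ex_class_of (iffLR (torsion_slice z) tz) (iffLR (d0 z) dz).
  (* The class of a cocycle lying in x_i-degree c has no components elsewhere, as they are
     represented by 0. *)
  have xs : x \in @slice_pred k n i c H.
    apply/asboolP => a nac; apply: class0; have := class_of_hcomp a xz.
    by rewrite slice_mem (negbTE nac).
  by exists (exist (fun x => x \in @slice_pred k n i c H) x xs), z.
move=> x y [z xz yz]; rewrite (class_of_eq0 yz) -slice_coboundary -(class_of_eq0 xz).
by split=> [->//|x0]; exact: val_inj.
Qed.

End SliceCohomology.

(** * Slices of Stanley-Reisner rings *)

Section Monomials.
Variables (k : fieldType) (n : nat).
Local Notation A := {ffun 'I_n -> int}.

Definition msupport (m : 'X_{1..n}) : {set 'I_n} := [set j | m j != 0%N].

(** Closure under subsets is used from left to right: a support that contains a nonface is itself a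
    nonface. *)
Lemma nonface_idealP (D : {set {set 'I_n}}) (p : {mpoly k[n]}) : is_complex D ->
  monomial_ideal (nonface_monomial D) p <->
  (forall m, m \in msupp p -> msupport m \notin D).
Proof.
move=> Dc; split=> [[s sD ->] m|pD].
  move=> /(msupp_sum_le) /flattenP[_ /mapP[u us ->]].
  rewrite mem_filter /= in us.
  move=> /msuppM_le /allpairsP[[m1 m2] /= [_ m2u ->]].
  move: m2u; rewrite msuppX inE => /eqP ->.
  have [t tD ->] := sD _ us; apply: contraNN tD => /Dc; apply.
  apply/subsetP => j jt; rewrite inE mnmDE mnmE jt.
  by rewrite addn1.
(* Each monomial is divisible by the squarefree monomial of its own support, which is a
   generator. *)
exists [seq (p@_m *: 'X_[m - sqfree (msupport m)], sqfree (msupport m)) | m <- msupp p].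
  by move=> u /mapP[m /pD mD ->]; exists (msupport m).
rewrite big_map {1}[p]mpolyE; apply: eq_bigr => m _ /=.
rewrite -scalerAl -mpolyXD submK //; apply/mnm_lepP => j.
by rewrite mnmE inE; case: (m j).
Qed.

Lemma wdeg_fine (m : 'X_{1..n}) : wdeg (@fine_deg n) m = [ffun j => (m j)%:Z].
Proof.
apply/ffunP => j; rewrite /wdeg sum_ffunE ffunE (bigD1 j) //= ffunMnE ffunE eqxx.
rewrite big1 ?addr0 => [|l nlj]; first by rewrite -[true%:R]/(1 : int) natz.
by rewrite ffunMnE ffunE eq_sym (negbTE nlj) mul0rn.
Qed.

End Monomials.

Section StanleyReisnerSlice.
Variables (k : fieldType) (n : nat) (i : 'I_n).
Local Notation A := {ffun 'I_n -> int}.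
Local Notation A' := {ffun 'I_n.-1 -> int}.

Definition mnm_join (e : nat) (m : 'X_{1..n.-1}) : 'X_{1..n} :=
  [multinom if unlift i l is Some j then m j else e | l < n].

Definition mnm_rest (m : 'X_{1..n}) : 'X_{1..n.-1} := [multinom m (lift i j) | j < n.-1].

Lemma mnm_join_eq e (m : 'X_{1..n}) m' :
  (mnm_join e m' == m) = (m i == e) && (m' == mnm_rest m).
Proof.
apply/eqP/andP => [<-|[/eqP <- /eqP ->]]; last first.
  by apply/mnmP => l; rewrite mnmE; case: unliftP => [j ->|->]; rewrite ?mnmE.
rewrite mnmE unlift_none; split=> //; apply/eqP/mnmP => j.
by rewrite !mnmE liftK.
Qed.

Lemma mnm_join_rest (m : 'X_{1..n}) : mnm_join (m i) (mnm_rest m) = m.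
Proof. by apply/eqP; rewrite mnm_join_eq !eqxx. Qed.

Lemma msupport_join e m : msupport (mnm_join e m) =
  if e == 0%N then lift i @: msupport m else i |: lift i @: msupport m.
Proof.
have liftE j : (lift i j \in lift i @: msupport m) = (m j != 0%N).
  by rewrite (mem_imset _ _ (@lift_inj _ i)) inE.
have iN : i \notin lift i @: msupport m.
  by apply/imsetP => -[j _ /eqP]; rewrite (negbTE (neq_lift _ _)).
apply/setP => l; rewrite !inE mnmE; case: (e =P 0%N) => e0;
  case: (unliftP i l) => [j ->|->].
- by rewrite liftE.
- by rewrite (negbTE iN) e0.
- by rewrite in_setU1 liftE (eq_sym _ i) (negbTE (neq_lift _ _)).
- by rewrite in_setU1 eqxx; apply/eqP.
Qed.

(** Multiplication by x_i^e identifies S' with the x_i-degree e part of S. *)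
Definition xi_incl (e : nat) (s : {mpoly k[n.-1]}) : {mpoly k[n]} :=
  'X_i ^+ e * sub_incl i s.

Lemma xi_incl_monom e m : xi_incl e 'X_[m] = 'X_[mnm_join e m].
Proof.
rewrite /xi_incl /sub_incl mmapX [RHS]mpolyXE_id (bigD1 i) //= mnmE unlift_none.
congr (_ * _); rewrite /mmap1.
have -> : \prod_(j < n | j != i) ('X_j ^+ mnm_join e m j : {mpoly k[n]}) =
  \prod_(j < n | j != i) (if unlift i j is Some j' then 'X_j ^+ m j' else 1).
  apply: eq_bigr => l; rewrite mnmE; case: unliftP => [j ->//|->].
  by rewrite eqxx.
rewrite (reindex_omap (lift i) (unlift i)) /=; last first.
  by move=> j ji; case: unliftP ji => [j' ->|->] //; rewrite eqxx.
rewrite [RHS](eq_bigl xpredT) => [|j]; first by apply: eq_bigr => j _; rewrite liftK.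
by rewrite liftK eqxx eq_sym neq_lift.
Qed.

Lemma xi_inclE e s (m : 'X_{1..n}) :
  (xi_incl e s)@_m = if m i == e then s@_(mnm_rest m) else 0.
Proof.
elim/mpolyind: s => [|c m' p _ _ IHp].
  by rewrite /xi_incl rmorph0 mulr0 !mcoeff0 if_same.
rewrite /xi_incl rmorphD mulrDr mcoeffD [X in _ + X]IHp.
rewrite -mul_mpolyC rmorphM /= {1}/sub_incl mmapC mulrCA -/(xi_incl e _) xi_incl_monom.
rewrite mcoeffCM mcoeffX mnm_join_eq mcoeffD mcoeffCM mcoeffX.
by case: (m i == e); rewrite /= ?mulr0 ?addr0.
Qed.

Lemma xi_incl_slice_pred (P : hsubmod (greg k (@fine_deg n))) e s :
  (quo_pi P (xi_incl e s) : restrict i (gquo P)) \in @slice_pred k n i e%:Z (gquo P).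
Proof.
apply/asboolP => a ae; rewrite -[LHS]/(quo_hcomp a (quo_pi P (xi_incl e s))) quo_hcompE.
rewrite -[RHS](quo_pi0 P); congr quo_pi; apply/mpolyP => m.
rewrite -[LHS]/((reg_hcomp _ a _)@_m) reg_hcompE mcoeff0 xi_inclE wdeg_fine.
case: eqP => // am; case: eqP => // me.
by rewrite -am ffunE me eqxx in ae.
Qed.

Lemma xi_incl_hcomp e b (s : {mpoly k[n.-1]}) :
  reg_hcomp (@fine_deg n) (deg_join i e%:Z b) (xi_incl e s) =
  xi_incl e (reg_hcomp (@fine_deg n.-1) b s).
Proof.
apply/mpolyP => m; rewrite reg_hcompE !xi_inclE reg_hcompE !wdeg_fine (deg_eq i).
rewrite deg_joinE deg_rest_join !ffunE eqz_nat; case: (m i == e) => //=.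
congr (if _ == b then _ else _).
by apply/ffunP => j; rewrite !ffunE mnmE.
Qed.

Lemma xi_incl_surj e (p : {mpoly k[n]}) :
  (forall m, m \in msupp p -> m i = e) -> exists s, p = xi_incl e s.
Proof.
move=> pe; exists (\sum_(m <- msupp p) p@_m *: 'X_[mnm_rest m]).
rewrite /xi_incl rmorph_sum mulr_sumr {1}[p]mpolyE; apply: eq_big_seq => m /pe me.
rewrite -!mul_mpolyC rmorphM /= {1}/sub_incl mmapC mulrCA -/(xi_incl e _).
by rewrite xi_incl_monom -me mnm_join_rest.
Qed.

(** By the hypothesis on D', x_i^e s lies in the ideal of D exactly when s lies in that of D': the
    support of x_i^e x^m is that of x^m, with i added when e > 0. The class of x_i^e s is then
    matched with the class of s. *)
Lemma stanley_reisner_slice (D : {set {set 'I_n}}) (D' : {set {set 'I_n.-1}}) e :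
  is_complex D -> is_complex D' ->
  (forall s, (s \in D') =
     ((if e == 0%N then lift i @: s else i |: lift i @: s) \in D)) ->
  giso (slice i e%:Z (stanley_reisner k D)) (stanley_reisner k D').
Proof.
move=> Dc D'c DD'.
set P := gmideal k (@fine_deg n) (nonface_monomial D).
set P' := gmideal k (@fine_deg n.-1) (nonface_monomial D').
have PP' s : xi_incl e s \in hsub_pred P <-> s \in hsub_pred P'.
  split=> [/asboolP/(nonface_idealP _ Dc) h|/asboolP/(nonface_idealP _ D'c) h].
    apply/asboolP/(nonface_idealP _ D'c) => m ms; rewrite DD' -msupport_join; apply: h.
    have /andP[/eqP me /eqP mr] : (mnm_join e m i == e) && (m == mnm_rest (mnm_join e m)).
      by rewrite -mnm_join_eq.
    by rewrite mcoeff_msupp xi_inclE me eqxx -mr -mcoeff_msupp.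
  apply/asboolP/(nonface_idealP _ Dc) => m.
  rewrite mcoeff_msupp xi_inclE; case: (m i =P e) => [me|_]; last by rewrite eqxx.
  by rewrite -mcoeff_msupp => /h; rewrite DD' -msupport_join -me mnm_join_rest.
pose sv (x : slice i e%:Z (gquo P)) : gquo P := val (x : slice_sort i e%:Z (gquo P)).
apply: (@giso_of_relation _ _ _ _ (slice i e%:Z (gquo P)) (gquo P') (fun x y =>
  exists2 s, sv x = quo_pi P (xi_incl e s) & y = quo_pi P' s)).
- move=> s x y x' y' [t xt ->] [t' xt' ->]; exists (s * t + t'); last first.
    by rewrite quo_piD quo_piZ.
  rewrite -[LHS]/(sub_incl i s *: sv x + sv x') xt xt' -quo_piZ -quo_piD.
  congr quo_pi; rewrite -[sub_incl i s *: _]/(sub_incl i s * _).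
  by rewrite /xi_incl rmorphD rmorphM mulrDr mulrCA.
- move=> b x y [s xs ->]; exists (reg_hcomp (@fine_deg n.-1) b s).
    rewrite -xi_incl_hcomp -[LHS]/(hcomp (deg_join i e%:Z b) (sv x)) xs.
    exact: (quo_hcompE P).
  exact: (quo_hcompE P').
- move=> x; have [p xp] := quo_piK (sv x).
  (* The terms of p of other x_i-degrees vanish in the quotient, as x lies in the slice; the
     x_i-degree e part of p represents x as well. *)
  have [p' p'E _] := slice_part_ex i e%:Z (p : greg k (@fine_deg n)).
  have [s sE] : exists s, val (p' : slice_sort i e%:Z _) = xi_incl e s.
    apply: xi_incl_surj => m; rewrite mcoeff_msupp => pm; apply/eqP; apply: contraNT pm.
    move=> mie; have := p'E (wdeg (@fine_deg n) m).
    rewrite wdeg_fine ffunE eqz_nat (negbTE mie) => /(congr1 (mcoeff m)).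
    rewrite -[X in mcoeff m X = _]/(reg_hcomp _ _ _) reg_hcompE wdeg_fine.
    rewrite eqxx => ->.
    by rewrite mcoeff0.
  exists (quo_pi P' s), s => //; rewrite -sE; apply/esym.
  apply: (slice_val_ext (x := x)) => a ae;
    rewrite -[LHS]/(quo_hcomp _ (quo_pi P _)) quo_hcompE.
    by rewrite p'E ae eqxx -[RHS]/(hcomp a (sv x)) xp -[RHS]/(quo_hcomp _ _) quo_hcompE.
  by rewrite p'E (negbTE ae) quo_pi0.
- move=> y; have [s ->] := quo_piK y.
  have sl := xi_incl_slice_pred P e s.
  by exists (exist (fun x => x \in @slice_pred k n i e%:Z (gquo P)) _ sl), s.
move=> x y [s xs ->]; rewrite -(quo_pi0 P').
have -> : x = 0 <-> sv x = 0 by split=> [->//|x0]; exact: val_inj.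
by rewrite xs -(quo_pi0 P) !quo_eqP !subr0.
Qed.

Lemma on_complement_complex (D : {set {set 'I_n}}) :
  is_complex D -> is_complex (on_complement i D).
Proof. by move=> Dc s t; rewrite !inE => sD ts; apply: (Dc _ _ sD); exact: imsetS. Qed.

Lemma lift_imset_notin (s : {set 'I_n.-1}) : i \notin lift i @: s.
Proof. by apply/imsetP => -[j _ /eqP]; rewrite (negbTE (neq_lift _ _)). Qed.

Lemma slice0_stanley_reisner (D : {set {set 'I_n}}) : is_complex D ->
  giso (slice i 0 (stanley_reisner k D))
       (stanley_reisner k (on_complement i (deletion i D))).
Proof.
move=> Dc; apply: (stanley_reisner_slice (e := 0)) => //.
  apply: on_complement_complex => s t; rewrite !inE => /andP[sD si] ts.
  by rewrite (Dc _ _ sD ts) /=; apply: contraNN si; exact: (subsetP ts).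
by move=> s; rewrite !inE lift_imset_notin andbT.
Qed.

Lemma sliceS_stanley_reisner (D : {set {set 'I_n}}) e : is_complex D ->
  giso (slice i e.+1%:Z (stanley_reisner k D))
       (stanley_reisner k (on_complement i (link i D))).
Proof.
move=> Dc; apply: stanley_reisner_slice => //.
  apply: on_complement_complex => s t; rewrite !inE => /andP[si sD] ts.
  rewrite (Dc _ _ sD) ?setUS // andbT.
  by apply: contraNN si; exact: (subsetP ts).
by move=> s; rewrite !inE lift_imset_notin.
Qed.

Lemma slice_neg_stanley_reisner (D : {set {set 'I_n}}) c
    (x : slice i c (stanley_reisner k D)) : c < 0 -> x = 0.
Proof.
move=> c0; apply: val_inj; apply: (@hcomp_ext _ _ _ _ (stanley_reisner k D)) => a.
rewrite raddf0 slice_mem; case: eqP => // ac.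
have [p ->] := quo_piK
  (val (x : slice_sort i c (stanley_reisner k D)) : stanley_reisner k D).
rewrite -[LHS]/(quo_hcomp _ _) quo_hcompE -quo_pi0; congr quo_pi.
apply/mpolyP => m; rewrite -[LHS]/((reg_hcomp _ a _)@_m) reg_hcompE mcoeff0 wdeg_fine.
by case: eqP => // am; rewrite -ac -am ffunE in c0.
Qed.

End StanleyReisnerSlice.

(** An element of degree (c; b) already lies in the slice, where it has degree b; the isomorphism
    restricts to these components. *)
Lemma component_slice (k : fieldType) n (i : 'I_n) (c : int) (H : gmod k (@fine_deg n))
    (L : gmod k (@fine_deg n.-1)) b : giso (slice i c H) L ->
  linear_iso (component H (deg_join i c b)) (component L b).
Proof.
case=> f [g fK gK]; set a := deg_join i c b.
have sl (x : component H a) : (val x : restrict i H) \in @slice_pred k n i c H.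
  apply/asboolP => a' na'; have /eqP <- := valP x.
  rewrite -[LHS]/(hcomp a' (hcomp a (val x : H))) hcomp_id; case: eqP => // e.
  by rewrite e deg_joinE eqxx in na'.
pose s (x : component H a) : slice i c H :=
  exist (fun y => y \in @slice_pred k n i c H) _ (sl x).
have sh (x : component H a) : hcomp b (s x) = s x.
  by apply: val_inj; rewrite slice_hcomp_val; exact/eqP/(valP x).
have fh (x : component H a) : (f (s x) : kmod L) \in homog_pred b.
  by apply/eqP; rewrite -ghom_hcomp sh.
pose F (x : component H a) : component L b :=
  exist (fun y => y \in homog_pred b) _ (fh x).
have gh (y : component L b) :
    (val (g (val y : L) : slice_sort i c H) : kmod H) \in homog_pred a.
  apply/eqP; rewrite -[LHS]slice_hcomp_val; congr (val _); apply: (can_inj fK).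
  by rewrite ghom_hcomp gK; exact/eqP/(valP y).
pose G (y : component L b) : component H a :=
  exist (fun x => x \in homog_pred a) _ (gh y).
have Fl : linear F.
  move=> d x y; apply: val_inj; rewrite -[RHS]/(d%:MP *: f (s x) + f (s y)) -linearP.
  rewrite -[LHS]/(f _); congr (f _); apply: val_inj.
  by rewrite -[RHS]/(d%:MP *: (val x : restrict i H) + val y) restrict_scaleC.
pose FL := GRing.isLinear.Build _ _ _ _ F Fl.
pose FF : {linear component H a -> component L b} := HB.pack F FL.
exists FF; exists G => [x|y]; apply: val_inj.
  by rewrite -[LHS]/(val (g (f (s x)) : slice_sort i c H)) fK.
rewrite -[RHS]gK -[LHS]/(f _); congr (f _); exact: val_inj.
Qed.

(** * Gluing the slices *)

Section Assembly.
Variables (k : fieldType) (n : nat) (i : 'I_n) (H : gmod k (@fine_deg n)).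
Local Notation A := {ffun 'I_n -> int}.

Definition is_part c (x : H) (y : slice i c H) : Prop :=
  forall a : A, hcomp a (val (y : slice_sort i c H)) = if a i == c then hcomp a x else 0.

Lemma is_part_linear c (s : {mpoly k[n.-1]}) (x x' : restrict i H) (y y' : slice i c H) :
  is_part x y -> is_part x' y' -> is_part (s *: x + x') (s *: y + y').
Proof.
move=> xy xy' a; rewrite -[val _]/(s *: (val (y : slice_sort i c H) : restrict i H) +
  val (y' : slice_sort i c H)).
rewrite (hcompD (g := restrict i H)) [X in _ + X]xy' [in RHS](hcompD (g := restrict i H)).
suff -> : hcomp a (s *: (val (y : slice_sort i c H) : restrict i H)) =
    if a i == c then hcomp a (s *: x) else 0 by case: ifP => //; rewrite addr0.
elim/mpoly_generators_ind: s a => [d|p q IHp IHq|j p IHp] a.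
- by rewrite !hcompC [X in _ *: X]xy; case: ifP => // _; rewrite scaler0.
- by rewrite !scalerDl !hcompD IHp IHq; case: ifP => // _; rewrite addr0.
rewrite -!scalerA !hcompX_sub IHp.
have -> : (a - sub_deg i j) i = a i.
  by have := sub_deg_i i j (a - sub_deg i j); rewrite addrC subrK => <-.
by case: ifP => // _; rewrite scaler0.
Qed.

Lemma is_part_hcomp c a (x : H) (y : slice i c H) : is_part x y ->
  is_part (hcomp a x) (if a i == c then hcomp (deg_rest i a) y else 0).
Proof.
move=> xy a'; case: (eqVneq (a i) c) => [ac|nac].
  have aE : deg_join i c (deg_rest i a) = a by rewrite -ac deg_join_rest.
  rewrite slice_hcomp_val aE !hcomp_id xy ac eqxx.
  by case: (eqVneq a' a) => [->|_]; rewrite ?ac ?eqxx ?if_same.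
rewrite raddf0 hcomp_id; case: (eqVneq a' a) => [->|_]; last by rewrite if_same.
by rewrite (negbTE nac).
Qed.

Lemma is_part_inj c (x : H) (y y' : slice i c H) : is_part x y -> is_part x y' -> y = y'.
Proof.
move=> xy xy'; apply: val_inj; apply: (@hcomp_ext _ _ _ _ H) => a.
by rewrite xy xy'.
Qed.

Lemma is_part0 c : is_part (0 : H) (0 : slice i c H).
Proof. by move=> a; rewrite !raddf0 if_same. Qed.

(** The relation [r] compares each slice of x with the matching entry of y: degree 0 with the first
    summand, degree e + 1 with index e + 1 of the family. Here index and x_i-degree coincide,
    without the shift of [induced]. *)
Lemma assemble_slices (H0 H1 : gmod k (@fine_deg n.-1)) :
  giso (slice i 0 H) H0 -> (forall e : nat, giso (slice i e.+1%:Z H) H1) ->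
  (forall c, c < 0 -> forall x : slice i c H, x = 0) ->
  giso (restrict i H) (gdsum (in_deg0 i H0) (tensor_xk i H1)).
Proof.
move=> [f0 [g0 f0K g0K]] iso1 neg.
pose f e := projT1 (cid (iso1 e)).
have /(_ _)/cid f_bij e : exists g, cancel (f e) g /\ cancel g (f e).
  by rewrite /f; case: cid => h [g gK hK]; exists g.
pose g e := projT1 (f_bij e).
have fK e : cancel (f e) (g e) by rewrite /g; case: (f_bij e) => ? [].
have gK e : cancel (g e) (f e) by rewrite /g; case: (f_bij e) => ? [].
have part c x : exists y : slice i c H, is_part x y.
  by have [y yE _] := slice_part_ex i c x; exists y.
pose r (x : restrict i H) (y : gdsum (in_deg0 i H0) (tensor_xk i H1)) :=
  (exists2 z : slice i 0 H, is_part x z & f0 z = y.1) /\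
  (forall e, exists2 z : slice i e.+1%:Z H, is_part x z &
     f e z = val (y.2 : txk_sort H1) e.+1).
apply: (@giso_of_relation _ _ _ _ _ _ r).
- move=> s x y x' y' [[z xz zy] xy] [[z' xz' zy'] xy']; split=> [|e].
    by exists (s *: z + z'); [exact: is_part_linear|rewrite linearP zy zy'].
  have [u xu uy] := xy e; have [u' xu' uy'] := xy' e.
  by exists (s *: u + u'); [exact: is_part_linear|rewrite linearP uy uy'].
- move=> a x y [[z xz zy] xy]; split=> [|e].
    exists (if a i == 0 then hcomp (deg_rest i a) z else 0); first exact: is_part_hcomp.
    rewrite -[RHS]/(deg0_hcomp i a y.1) /deg0_hcomp; case: ifP => _; last exact: raddf0.
    by rewrite ghom_hcomp zy.
  have [u xu uy] := xy e.
  exists (if a i == e.+1%:Z then hcomp (deg_rest i a) u else 0).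
    exact: is_part_hcomp.
  rewrite -[RHS]/(val (txk_hcomp i a (y.2 : txk_sort H1)) e.+1) txk_hcompE.
  case: ifP => _; last exact: raddf0.
  by rewrite ghom_hcomp uy.
- move=> x; have [z xz] := part 0 x.
  pose u e := projT1 (cid (part e.+1%:Z x)).
  have xu e : is_part x (u e) by rewrite /u; case: cid.
  pose h d := if d is e.+1 then f e (u e) else 0.
  have hfin : h \in @txk_pred k n H1.
    apply/asboolP; split=> //; have [s _ xE] := hcomp_sum (x : H).
    (* Beyond the largest absolute x_i-degree among the finitely many components of x, its parts are
       zero. *)
    exists (\max_(a <- s) `|a i|)%N => -[//|e] se.
    rewrite /h (_ : u e = 0) ?raddf0 //; apply: (is_part_inj (xu e)) => a.
    rewrite raddf0; case: eqP => // ae; rewrite xE raddf_sum big_seq big1 // => b bs.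
    rewrite /= hcomp_id; case: eqP => // ab.
    have : (`|b i| <= \max_(a <- s) `|a i|)%N.
      by rewrite (big_rem b) //= leq_maxl.
    by rewrite -ab ae leqNgt se.
  exists (f0 z, (exist (fun y => y \in @txk_pred k n H1) h hfin : txk_sort H1)).
  by split=> [|e]; [exists z|exists (u e)].
- move=> [y h]; have /asboolP[h0 [N hN]] := valP (h : txk_sort H1).
  pose u e : slice i e.+1%:Z H := g e (val (h : txk_sort H1) e.+1).
  (* The preimage is the sum of the pulled-back entries; e < N covers the indices 1 to N, outside of
     which h vanishes. *)
  pose x : H := val (g0 y : slice_sort i 0 H) + \sum_(e < N) val (u e : slice_sort i _ H).
  have xE a : hcomp a x =
      (if a i == 0 then hcomp a (val (g0 y : slice_sort i 0 H)) else 0) +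
      \sum_(e < N) if a i == e.+1%:Z then hcomp a (val (u e : slice_sort i _ H)) else 0.
    rewrite /x hcompD slice_mem raddf_sum; congr (_ + _).
    by apply: eq_bigr => e _; rewrite /= slice_mem.
  exists x; split=> [|e].
    exists (g0 y) => [a|]; last by rewrite g0K.
    rewrite slice_mem xE; case: eqP => // ->.
    by rewrite big1 ?addr0.
  exists (u e) => [a|]; last by rewrite gK.
  rewrite slice_mem xE; case: eqP => // ae; rewrite ae add0r.
  have [eN|Ne] := ltnP e N; last first.
    have -> : u e = 0 by apply: (can_inj (fK e)); rewrite gK hN // raddf0.
    rewrite raddf0 big1 // => d _; case: eqP => // -[ed].
    by have := ltn_ord d; rewrite -ed ltnNge Ne.
  rewrite (bigD1 (Ordinal eN)) //= eqxx big1 ?addr0 // => d nde.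
  by rewrite eqz_nat eqSS -[e]/(val (Ordinal eN)) val_eqE eq_sym (negbTE nde).
move=> x [y h] [[z xz zy] xy]; split=> [x0|[y0 h0]].
  congr (_, _).
    apply: etrans (esym zy) _.
    by rewrite (is_part_inj xz (y' := 0)) ?raddf0 // x0; exact: is_part0.
  apply: txk_eq => -[|e]; first by have /asboolP[-> _] := valP (h : txk_sort H1).
  have [u xu uy] := xy e; apply: etrans (esym uy) _.
  by rewrite (is_part_inj xu (y' := 0)) ?raddf0 // x0; exact: is_part0.
(* The component of degree a is visible in the slice of x_i-degree [a i], and each such slice of x
   is zero: by the first entry, by the family, or by [neg]. *)
apply: (@hcomp_ext _ _ _ _ H) => a; rewrite raddf0.
suff [w wx w0] : exists2 w : slice i (a i) H, is_part x w & w = 0.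
  by have := wx a; rewrite w0 eqxx raddf0.
case ai: (a i) => [[|e]|e].
- by exists z => //; apply: (can_inj f0K); rewrite zy raddf0 y0.
- have [u xu uy] := xy e; exists u => //; apply: (can_inj (fK e)).
  by rewrite uy /= h0 raddf0.
by have [w xw] := part (Negz e) x; exists w => //; exact: neg.
Qed.

End Assembly.

Theorem theorem2p5 (k : fieldType) (n : nat) (i : 'I_n) (D : {set {set 'I_n}})
    (D_complex : is_complex D) (D_vertices : has_all_vertices D)
    (R : ginjective_resolution (stanley_reisner k D))
    (Rdel : ginjective_resolution
              (stanley_reisner k (on_complement i (deletion i D))))
    (Rlk : ginjective_resolution
              (stanley_reisner k (on_complement i (link i D))))
    (q : nat) :
  let H := local_cohomology (vertex_prime i) R q in
  let Hdel := local_cohomology (@max_ideal n.-1) Rdel q in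
  let Hlk := local_cohomology (@max_ideal n.-1) Rlk q in
  giso (restrict i H) (gdsum (in_deg0 i Hdel) (tensor_xk i Hlk)) /\
  (forall (c : int) (b : {ffun 'I_n.-1 -> int}),
    [/\ c = 0 -> linear_iso (component H (deg_join i c b)) (component Hdel b),
        1 <= c -> linear_iso (component H (deg_join i c b)) (component Hlk b) &
        c <= -1 -> forall x : component H (deg_join i c b), x = 0]).
Proof.
move=> H Hdel Hlk.
(* The sliced resolution and [Rdel] resolve isomorphic modules, so only the change of resolution
   remains. *)
have iso0 : giso (slice i 0 H) Hdel.
  apply: giso_trans (slice_local_cohomology _ _ _ _) _.
  exact/local_cohomology_giso/slice0_stanley_reisner.
have isoS e : giso (slice i e.+1%:Z H) Hlk.
  apply: giso_trans (slice_local_cohomology _ _ _ _) _.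
  exact/local_cohomology_giso/sliceS_stanley_reisner.
(* For c < 0 the sliced resolution resolves the zero module. *)
have trivial c : c < 0 ->
    forall y : local_cohomology (@max_ideal n.-1) (slice_resolution i c R) q, y = 0.
  move=> c0 y; apply: local_cohomology_trivial => z.
  exact: slice_neg_stanley_reisner.
split=> [|c b].
  apply: assemble_slices => // c c0 x.
  have [f [g fK _]] := slice_local_cohomology i c R q.
  by apply: (can_inj fK); rewrite raddf0; exact: (trivial c c0).
split=> [->|c1|cN1 x]; first exact: component_slice.
  by case: c c1 => [[|e]|e] // _; exact: component_slice.
have c0 : c < 0 by apply: le_lt_trans cN1 _.
have [f [g fK _]] := component_slice b (slice_local_cohomology i c R q).
have f0 y : val (f y) = 0 by exact: (trivial c c0).
by apply: (can_inj fK); apply: val_inj; rewrite !f0.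
Qed.
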